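(* Suppose that the continuous-time mixed design problem $\min_{K\in\mathcal{K}}\mathcal{J}(K)$ admits a global optimal solution in $\mathcal{K}$, and that $(A,C)$ is detectable. Then one such solution $K^*\in\mathcal{K}$ has the form $K^*=R^{-1}B^\top P_{K^*}$. Additionally, if the pair $\big(A-BK+\gamma^{-2}DD^\top P_K,\,D\big)$ is controllable at some stationary point $K\in\mathcal{K}$ of $\mathcal{J}$, i.e., one with $\nabla\mathcal{J}(K)=0$, then this $K$ is the unique stationary point, and it corresponds to the unique global optimizer $K^*$.
   Context: Setting (continuous-time mixed $\mathcal{H}_2/\mathcal{H}_\infty$ design). $A\in\mathbb{R}^{m\times m}$, $B\in\mathbb{R}^{m\times d}$, $C\in\mathbb{R}^{l\times m}$, $D\in\mathbb{R}^{m\times n}$, $E\in\mathbb{R}^{l\times d}$ are real matrices satisfying $E^\top[C\ \ E]=[0\ \ R]$ for some $R>0$, and $\gamma>0$. Gains are $K\in\mathbb{R}^{d\times m}$. $X>0$ ($X\ge0$) denotes (symmetric) positive definite (semidefinite). A matrix is Hurwitz if all its eigenvalues have negative real part. Transfer function: $\mathcal{T}(K)(s)=(C^\top C+K^\top RK)^{1/2}(sI-(A-BK))^{-1}D$, with $\|\mathcal{T}(K)\|_\infty=\sup_{\omega\in\mathbb{R}}\sigma_{\max}[\mathcal{T}(K)(j\omega)]$. Feasible set: $\mathcal{K}=\{K: A-BK\text{ is Hurwitz},\ \|\mathcal{T}(K)\|_\infty<\gamma\}$. For $K\in\mathcal{K}$, $P_K\ge0$ denotes the unique stabilizing solution (it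 exists by the continuous-time Bounded Real Lemma) of $(A-BK)^\top P_K+P_K(A-BK)+C^\top C+K^\top RK+\gamma^{-2}P_KDD^\top P_K=0$, i.e., the unique solution with $A-BK+\gamma^{-2}DD^\top P_K$ Hurwitz. Cost: $\mathcal{J}(K)=\mathrm{tr}(P_KDD^\top)$ for $K\in\mathcal{K}$; it is differentiable on $\mathcal{K}$. *)

(* Defs.v *)
From mathcomp Require Import all_boot all_order all_algebra.
From mathcomp Require Import complex.
From mathcomp Require Import all_classical all_reals all_analysis.

Set Implicit Arguments.
Unset Strict Implicit.
Unset Printing Implicit Defensive.

Import Order.TTheory GRing.Theory Num.Theory.
Import numFieldNormedType.Exports.

Local Open Scope classical_set_scope.
Local Open Scope ring_scope.
Local Open Scope complex_scope.
Local Open Scope sesquilinear_scope.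

(* All dimensions are arbitrary natural numbers; dimension 0 is not excluded. *)

Definition psd (R : realType) (k : nat) (P : 'M[R]_k) : Prop :=
  P^T = P /\ forall x : 'cV[R]_k, 0 <= (x^T *m P *m x) 0 0.

Definition posdef (R : realType) (k : nat) (P : 'M[R]_k) : Prop :=
  P^T = P /\ forall x : 'cV[R]_k, x != 0 -> 0 < (x^T *m P *m x) 0 0.

Definition cmx (R : realType) (p q : nat) (M : 'M[R]_(p, q)) : 'M[R[i]]_(p, q) :=
  map_mx (fun x : R => x%:C) M.

Definition hurwitz (R : realType) (k : nat) (M : 'M[R]_k) : Prop :=
  forall z : R[i], eigenvalue (cmx M) z -> complex.Re z < 0.

Definition detectable (R : realType) (m l : nat)
    (A : 'M[R]_m) (C : 'M[R]_(l, m)) : Prop :=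
  exists L : 'M[R]_(m, l), hurwitz (A - L *m C).

(* Kalman's definition: [D, A D, ..., A^(m-1) D] has full row rank. *)
Definition controllable (R : realType) (m n : nat)
    (A : 'M[R]_m) (D : 'M[R]_(m, n)) : Prop :=
  \rank (\mxrow_(k < m) ((A ^+ k : 'M[R]_m) *m D)) = m.

(* The positive semidefinite square root, which exists and is unique when M is
   positive semidefinite; the value is 0 when there is none. *)
Definition psd_sqrt (R : realType) (k : nat) (M : 'M[R]_k) : 'M[R]_k :=
  xget 0 [set S : 'M[R]_k | psd S /\ S *m S = M].

(* Singular values are the nonnegative square roots of the eigenvalues of
   M^* M.  The set is finite, and it is empty only if M has no column, in
   which case sup gives 0. *)
Definition sigma_max (R : realType) (p q : nat) (M : 'M[R[i]]_(p, q)) : R :=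
  sup [set s : R | 0 <= s /\ eigenvalue (M ^t* *m M) (s ^+ 2)%:C].

Definition transfer (R : realType) (m n d l : nat) (A : 'M[R]_m)
    (B : 'M[R]_(m, d)) (C : 'M[R]_(l, m)) (D : 'M[R]_(m, n)) (Rw : 'M[R]_d)
    (K : 'M[R]_(d, m)) (s : R[i]) : 'M[R[i]]_(m, n) :=
  cmx (psd_sqrt (C^T *m C + K^T *m Rw *m K))
    *m invmx (s%:M - cmx (A - B *m K)) *m cmx D.

(* Extended-real valued, so that an unbounded frequency response has norm +oo. *)
Definition hinf_norm (R : realType) (p q : nat)
    (T : R[i] -> 'M[R[i]]_(p, q)) : \bar R :=
  ereal_sup [set (sigma_max (T (Complex 0 w)))%:E | w in [set: R]].

Definition feasible (R : realType) (m n d l : nat) (A : 'M[R]_m)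
    (B : 'M[R]_(m, d)) (C : 'M[R]_(l, m)) (D : 'M[R]_(m, n)) (Rw : 'M[R]_d)
    (gamma : R) : set 'M[R]_(d, m) :=
  [set K | hurwitz (A - B *m K) /\
           (hinf_norm (transfer A B C D Rw K) < gamma%:E)%E].

Definition stabilizing_solution (R : realType) (m n d l : nat) (A : 'M[R]_m)
    (B : 'M[R]_(m, d)) (C : 'M[R]_(l, m)) (D : 'M[R]_(m, n)) (Rw : 'M[R]_d)
    (gamma : R) (K : 'M[R]_(d, m)) (P : 'M[R]_m) : Prop :=
  [/\ psd P,
      (A - B *m K)^T *m P + P *m (A - B *m K) + C^T *m C + K^T *m Rw *m K
        + gamma ^- 2 *: (P *m D *m D^T *m P) = 0
    & hurwitz (A - B *m K + gamma ^- 2 *: (D *m D^T *m P))].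

(* P_K, by choice: for feasible K the stabilizing solution exists and is unique
   (Bounded Real Lemma), so the default value 0 is not used there. *)
Definition riccati_sol (R : realType) (m n d l : nat) (A : 'M[R]_m)
    (B : 'M[R]_(m, d)) (C : 'M[R]_(l, m)) (D : 'M[R]_(m, n)) (Rw : 'M[R]_d)
    (gamma : R) (K : 'M[R]_(d, m)) : 'M[R]_m :=
  xget 0 [set P | stabilizing_solution A B C D Rw gamma K P].

(* Only meaningful for feasible K. *)
Definition cost (R : realType) (m n d l : nat) (A : 'M[R]_m)
    (B : 'M[R]_(m, d)) (C : 'M[R]_(l, m)) (D : 'M[R]_(m, n)) (Rw : 'M[R]_d)
    (gamma : R) (K : 'M[R]_(d, m)) : R :=
  \tr (riccati_sol A B C D Rw gamma K *m D *m D^T).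

Definition gradient (R : realType) (d m : nat)
    (f : 'M[R]_(d, m) -> R) (K : 'M[R]_(d, m)) : 'M[R]_(d, m) :=
  \matrix_(i, j) 'D_(delta_mx i j) f K.

(* The feasible set is open, so the values of the cost outside it do not affect
   differentiability or the gradient at a feasible point. *)
Definition stationary (R : realType) (m n d l : nat) (A : 'M[R]_m)
    (B : 'M[R]_(m, d)) (C : 'M[R]_(l, m)) (D : 'M[R]_(m, n)) (Rw : 'M[R]_d)
    (gamma : R) (K : 'M[R]_(d, m)) : Prop :=
  [/\ feasible A B C D Rw gamma K,
      differentiable (cost A B C D Rw gamma) K
    & gradient (cost A B C D Rw gamma) K = 0].

Definition global_optimum (R : realType) (m n d l : nat) (A : 'M[R]_m)
    (B : 'M[R]_(m, d)) (C : 'M[R]_(l, m)) (D : 'M[R]_(m, n)) (Rw : 'M[R]_d)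
    (gamma : R) (K : 'M[R]_(d, m)) : Prop :=
  feasible A B C D Rw gamma K /\
  forall K' : 'M[R]_(d, m), feasible A B C D Rw gamma K' ->
    cost A B C D Rw gamma K <= cost A B C D Rw gamma K'.

(* Main.v *)
Require Import Defs.
From mathcomp Require Import all_boot all_order all_algebra.
From mathcomp Require Import complex.
From mathcomp Require Import all_classical all_reals all_analysis.
From mathcomp Require Import ring lra zify.

(** The game Riccati equation [A^T P + P A + C^T C - P (B Rw^-1 B^T - G) P = 0],
    with [G = gamma^-2 D D^T], has a stabilizing solution [Ps] as soon as one loop
    is feasible, and [Ps <= P_K] for every feasible [K].  To see this, perturb [P_K] to
    [P0 > 0] with a strict Riccati inequality.  The Hamiltonian matrix then has no
    imaginary eigenvalue, and on its stable subspace [X1; X2] the Lyapunov inequality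
    makes [X1^* X2 - X2^* P0^-1 X2] nonnegative; hence [X1] is invertible and
    [Ps = X2 X1^-1 <= P0].  The gain [Ks = Rw^-1 B^T Ps] is therefore optimal.

    For the second part, move from a feasible [K] along [H = Rw^-1 B^T P_K - K].  With
    [M = A - B K + G P_K] and [M^T X + X M = - 2 H^T Rw H], the cost decreases at
    rate at least [tr (X D D^T)] to first order.  At a stationary or optimal [K] this
    trace vanishes, so [H M^k D = 0] for all [k].  Controllability of one such pair
    [(M, D)] gives [H = 0] there, hence [K = Ks]; for any other such [K], a Sylvester
    equation on the controllable subspace shows that [P_K] and [Ps] agree on it, so its
    Krylov space is that of [Ks] and [K = Ks] again. *)

Set Implicit Arguments.
Unset Strict Implicit.
Unset Printing Implicit Defensive.

Import Order.TTheory GRing.Theory Num.Theory.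
Import numFieldNormedType.Exports.
Local Open Scope ring_scope.
Local Open Scope sesquilinear_scope.

(** * Complex matrices: adjoints, stability, Sylvester and Lyapunov equations *)

Ltac mx_expand :=
  rewrite ?(mulmxDl, mulmxDr, mulmxBl, mulmxBr, mulNmx, mulmxN, =^~ scalemxAl,
    =^~ scalemxAr, mulmx1, mul1mx, mul0mx, mulmx0, mulmxA).

(** Rewriting with [mxE] would also open the products; this rule and the next two peel off one layer
    only. *)
Lemma mxDE (V : zmodType) m n (X Y : 'M[V]_(m, n)) i j : (X + Y) i j = X i j + Y i j.
Proof. by rewrite mxE. Qed.

Lemma mxNE (V : zmodType) m n (X : 'M[V]_(m, n)) i j : (- X) i j = - X i j.
Proof. by rewrite mxE. Qed.

Lemma mxZE (R : nzRingType) m n a (X : 'M[R]_(m, n)) i j : (a *: X) i j = a * X i j.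
Proof. by rewrite mxE. Qed.

(* Reduces a matrix identity to an entrywise one in which every product of matrices
   is an atom, so that [ring] applies although matrices do not commute. *)
Ltac mx_norm :=
  mx_expand;
  repeat (let t := fresh "t" in set t := (mulmx _ _); clearbody t);
  apply/matrixP => ? ?; rewrite ?mxE.

Lemma trmx_add (V : zmodType) m n (X Y : 'M[V]_(m, n)) : (X + Y)^T = X^T + Y^T.
Proof. by apply/matrixP => i j; rewrite !mxE. Qed.

Lemma trmx_opp (V : zmodType) m n (X : 'M[V]_(m, n)) : (- X)^T = - X^T.
Proof. by apply/matrixP => i j; rewrite !mxE. Qed.

Lemma trmx_scale (R : nzRingType) m n a (X : 'M[R]_(m, n)) : (a *: X)^T = a *: X^T.
Proof. by apply/matrixP => i j; rewrite !mxE. Qed.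

Section Adjoint.
Variable C : numClosedFieldType.

Lemma trmxCM m n p (X : 'M[C]_(m, n)) (Y : 'M[C]_(n, p)) :
  (X *m Y)^t* = Y^t* *m X^t*.
Proof. by rewrite trmx_mul map_mxM. Qed.

Lemma trmxCD m n (X Y : 'M[C]_(m, n)) : (X + Y)^t* = X^t* + Y^t*.
Proof. by rewrite linearD map_mxD. Qed.

Lemma trmxCN m n (X : 'M[C]_(m, n)) : (- X)^t* = - X^t*.
Proof. by rewrite linearN map_mxN. Qed.

Lemma trmxCZ m n a (X : 'M[C]_(m, n)) : (a *: X)^t* = a^* *: X^t*.
Proof. by rewrite linearZ /= map_mxZ. Qed.

Lemma trmxC0 m n : (0 : 'M[C]_(m, n))^t* = 0.
Proof. by rewrite trmx0 map_mx0. Qed.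

Lemma trmxC1 n : (1%:M : 'M[C]_n)^t* = 1%:M.
Proof. by rewrite trmx1 map_mx1. Qed.

Lemma trmxCV n (X : 'M[C]_n) : (invmx X)^t* = invmx (X^t*).
Proof. by rewrite trmx_inv map_invmx. Qed.

Lemma unitmx_trmxC n (X : 'M[C]_n) : (X^t* \in unitmx) = (X \in unitmx).
Proof. by rewrite map_unitmx unitmx_tr. Qed.

Lemma trmxC_eq0 m n (X : 'M[C]_(m, n)) : (X^t* == 0) = (X == 0).
Proof. by rewrite map_mx_eq0 trmx_eq0. Qed.

Definition trmxCE := (trmxCM, trmxCD, trmxCN, trmxCZ, trmxC0, trmxC1, trmxCV, @trmxCK C).

(** Over [C] the relation [0 <=] already makes the form real. Hermitian symmetry is stated
    separately, as [Z^t* = Z], where it is needed. *)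
Definition hpsd k (Z : 'M[C]_k) := forall x : 'cV[C]_k, 0 <= (x^t* *m Z *m x) 0 0.
Definition hpd k (Z : 'M[C]_k) :=
  forall x : 'cV[C]_k, x != 0 -> 0 < (x^t* *m Z *m x) 0 0.

Lemma hpd_psd k (Z : 'M[C]_k) : hpd Z -> hpsd Z.
Proof.
move=> h x; have [->|/h/ltW//] := eqVneq x 0.
by rewrite mulmx0 mxE.
Qed.

Lemma hpsdD k (Y Z : 'M[C]_k) : hpsd Y -> hpsd Z -> hpsd (Y + Z).
Proof. by move=> hY hZ x; rewrite mulmxDr mulmxDl mxE addr_ge0. Qed.

Lemma hpsd_congr k l (Z : 'M[C]_k) (X : 'M[C]_(k, l)) :
  hpsd Z -> hpsd (X^t* *m Z *m X).
Proof. by move=> hZ x; have := hZ (X *m x); rewrite trmxCM !mulmxA. Qed.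

Lemma dot_ge0 k (x : 'cV[C]_k) : 0 <= (x^t* *m x) 0 0.
Proof.
by rewrite mxE; apply: sumr_ge0 => i _; rewrite !mxE mulrC -normCK exprn_ge0.
Qed.

Lemma dot_gt0 k (x : 'cV[C]_k) : x != 0 -> 0 < (x^t* *m x) 0 0.
Proof.
move=> x0; rewrite lt_def dot_ge0 andbT; apply: contra x0.
rewrite mxE psumr_eq0 => [/allP h|i _]; last by rewrite !mxE mulrC -normCK exprn_ge0.
apply/eqP/matrixP => i j; rewrite ord1 mxE.
have /h : i \in index_enum 'I_k by rewrite mem_index_enum.
by rewrite /= !mxE mulrC -normCK expf_eq0 /= normr_eq0 => /eqP.
Qed.

Lemma hpsd_gram k l (X : 'M[C]_(l, k)) : hpsd (X^t* *m X).
Proof. by move=> x; have := dot_ge0 (X *m x); rewrite trmxCM !mulmxA. Qed.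


Lemma form_rect k (P : 'M[C]_k) (a b : 'cV_k) :
  (a + 'i *: b)^t* *m P *m (a + 'i *: b) = a^t* *m P *m a + b^t* *m P *m b
    + 'i *: (a^t* *m P *m b - b^t* *m P *m a).
Proof.
rewrite !trmxCE conjCi; mx_expand; rewrite scalerA mulNr -expr2 sqrCi opprK scale1r.
by mx_norm; ring.
Qed.

Definition stable k (M : 'M[C]_k) :=
  forall z (v : 'cV[C]_k), v != 0 -> M *m v = z *: v -> 'Re z < 0.

(** [eigenvalue] speaks of row vectors; [M - z%:M] and its transpose are singular together. *)
Lemma eigenvalue_colP k (M : 'M[C]_k) z :
  reflect (exists2 v : 'cV[C]_k, M *m v = z *: v & v != 0) (eigenvalue M z).
Proof.
have E (N : 'M[C]_k) : eigenvalue N z = ~~ (N - z%:M \in unitmx).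
  by rewrite /eigenvalue /eigenspace kermx_eq0 row_free_unit.
have -> : eigenvalue M z = eigenvalue M^T z.
  by rewrite !E -unitmx_tr linearB /= tr_scalar_mx.
apply: (iffP eigenvalueP) => [[v hv v0]|[v hv v0]].
  by exists v^T; rewrite ?trmx_eq0 // -[M]trmxK -trmx_mul hv linearZ.
by exists v^T; rewrite ?trmx_eq0 // -trmx_mul hv linearZ.
Qed.

Lemma stableP k (M : 'M[C]_k) :
  stable M <-> forall z, eigenvalue M z -> 'Re z < 0.
Proof.
split=> [h z /eigenvalue_colP[v hv v0]|h z v v0 hv]; first exact: h hv.
by apply/h/eigenvalue_colP; exists v.
Qed.

Lemma stable_tr k (M : 'M[C]_k) : stable M -> stable M^T.
Proof.
move/stableP => h z v v0 hv; apply/h/eigenvalueP.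
by exists v^T; rewrite ?trmx_eq0 // -[M]trmxK -trmx_mul hv linearZ.
Qed.

Lemma stable_trmxC k (M : 'M[C]_k) : stable M -> stable (M^t*).
Proof.
move/stableP => h z v v0 hv; rewrite -Re_conj; apply: h; apply/eigenvalueP.
by exists (v^t*); rewrite ?trmxC_eq0 // -[M]trmxCK -trmxCM hv trmxCZ.
Qed.

(** The intertwining relation is assumed on the Krylov vectors [M ^+ k *m D] only. Induction on [k]
    gives the claim for monomials. *)
Lemma horner_mx_krylov p q r (N : 'M[C]_p.+1) (M : 'M[C]_q.+1)
    (X : 'M[C]_(p.+1, q.+1)) (D : 'M[C]_(q.+1, r)) (f : {poly C}) :
  (forall k, N *m X *m (M ^+ k *m D) = X *m (M ^+ k.+1 *m D)) ->
  horner_mx N f *m X *m D = X *m horner_mx M f *m D.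
Proof.
move=> h.
have hk k : N ^+ k *m X *m D = X *m M ^+ k *m D.
  elim: k => [|k IH]; first by rewrite !expr0 mul1mx mulmx1.
  by rewrite exprS -mulmxE -!mulmxA [N ^+ k *m _]mulmxA IH -!mulmxA mulmxA h.
rewrite -[f]coefK poly_def !rmorph_sum /= !(mulmx_suml, mulmx_sumr).
apply: eq_bigr => i _.
by rewrite !linearZ /= !rmorphXn /= !horner_mx_X -!scalemxAl hk.
Qed.

(* The characteristic polynomial of [M] kills [M], while its value at [- N^t*]
   is a product of invertible factors. *)
Lemma sylvester_krylov p q r (N : 'M[C]_p) (M : 'M[C]_q)
    (X : 'M[C]_(p, q)) (D : 'M[C]_(q, r)) :
  stable N -> stable M ->
  (forall k, N^t* *m X *m (M ^+ k *m D) + X *m (M ^+ k.+1 *m D) = 0) ->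
  X *m D = 0.
Proof.
case: p => [|p] in N X *; first by move=> *; apply: flatmx0.
case: q => [|q] in M X D *; first by move=> *; rewrite thinmx0 mul0mx.
move=> sN sM h; set f := char_poly M.
have hk k : (- N^t*) *m X *m (M ^+ k *m D) = X *m (M ^+ k.+1 *m D).
  by apply/eqP; rewrite !mulNmx eq_sym -subr_eq0 opprK addrC h.
have := horner_mx_krylov f hk.
rewrite Cayley_Hamilton mulmx0 mul0mx => e0.
suff: horner_mx (- N^t*) f \in unitmx.
  by move=> u; rewrite -(mulKmx u (X *m D)) [_ *m (X *m D)]mulmxA e0 mulmx0.
have [rs ers] := closed_field_poly_normal f.
rewrite (monicP (char_poly_monic M)) scale1r in ers.
have rsP z : z \in rs -> 'Re z < 0.
  move=> zrs; move/stableP: sM; apply.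
  by rewrite eigenvalue_root_char -/f ers root_prod_XsubC.
rewrite ers rmorph_prod /= big_seq.
apply: (big_ind (fun A : 'M[C]_p.+1 => A \in unitmx)) => [|A B hA hB|z /rsP zn].
- exact: unitmx1.
- by rewrite -mulmxE unitmx_mul hA.
rewrite rmorphB /= horner_mx_X horner_mx_C.
(* If the factor were singular, [z] would be an eigenvalue of [- N^t*], so [z] and [- z] would both
   have negative real part. *)
apply/negPn/negP => nu.
have /eigenvalue_colP[v hv v0] : eigenvalue (- N^t*) z.
  by rewrite /eigenvalue /eigenspace kermx_eq0 row_free_unit.
have : 'Re (- z) < 0.
  apply: (stable_trmxC sN v0); apply: (can_inj (@opprK _)).
  by rewrite -mulNmx hv scaleNr opprK.
by rewrite raddfN /= oppr_lt0 => /(lt_trans zn); rewrite ltxx.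
Qed.

Lemma sylvester p q (N : 'M[C]_p) (M : 'M[C]_q) (X : 'M[C]_(p, q)) :
  stable N -> stable M -> N^t* *m X + X *m M = 0 -> X = 0.
Proof.
move=> sN sM h; rewrite -[X]mulmx1; apply: (sylvester_krylov sN sM) => k.
case: q => [|q] in M X sM h *; first by apply/matrixP => i [].
by rewrite !mulmx1 exprS -mulmxE [X *m _]mulmxA -mulmxDl h mul0mx.
Qed.

End Adjoint.

(** * Lyapunov inequalities and the spectral theorem for Hermitian matrices *)

Section Lyapunov.
Variable C : numClosedFieldType.

Lemma hpsd_diag k (P : 'M[C]_k) (d : 'rV_k) : (forall i, 0 <= d 0 i) ->
  hpsd (P^t* *m diag_mx d *m P).
Proof.
move=> d0; apply: hpsd_congr => x.
rewrite -mulmxA mul_diag_mx mxE; apply: sumr_ge0 => i _; rewrite !mxE.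
by rewrite mulrCA mulr_ge0 // mulrC -normCK exprn_ge0.
Qed.

(** By the spectral theorem the diagonal entries are real eigenvalues, with the columns of [P^t*] as
    eigenvectors. *)
Lemma herm_psd_eigen k (Z : 'M[C]_k) : Z^t* = Z ->
  (forall z (v : 'cV[C]_k), v != 0 -> z \is Num.real -> Z *m v = z *: v -> 0 <= z) ->
  hpsd Z.
Proof.
move=> hZ h x.
have Zh : Z \is hermsymmx by apply/is_hermitianmxP; rewrite expr0 scale1r hZ.
have := hermitian_spectral_diag_real Zh.
have /orthomx_spectralP := hermitian_normalmx Zh.
have Pu := spectral_unitarymx Z.
rewrite invmx_unitary //; move: (spectralmx Z) (spectral_diag Z) Pu => P d Pu eZ dr.
have PP : P *m P^t* = 1%:M by apply/unitarymxP.
have d0 i : 0 <= d 0 i.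
  apply: (h (d 0 i) (P^t* *m delta_mx i 0)).
  - apply/eqP => /(congr1 (mulmx P)); rewrite mulmxA PP mul1mx mulmx0.
    by move/matrixP/(_ i 0)/eqP; rewrite !mxE !eqxx oner_eq0.
  - by move/mxOverP: dr; apply.
  - rewrite eZ -!mulmxA [P *m _]mulmxA PP mul1mx scalemxAr; congr (_ *m _).
    apply/matrixP => a b; rewrite mul_diag_mx !mxE.
    by case: eqVneq => [->|]; rewrite ?mulr0.
rewrite eZ; exact: hpsd_diag.
Qed.

Lemma form_norm_le k (M : 'M[C]_k) (x : 'cV[C]_k) :
  `|(x^t* *m M *m x) 0 0| <= (\sum_i \sum_j `|M i j|) * (x^t* *m x) 0 0.
Proof.
have xi i : `|x i 0| ^+ 2 <= (x^t* *m x) 0 0.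
  rewrite mxE (bigD1 i) //= !mxE [X in X + _]mulrC -normCK lerDl.
  by apply: sumr_ge0 => j _; rewrite !mxE mulrC -normCK exprn_ge0.
move: ((x^t* *m x) 0 0) xi => N xi.
rewrite -mulmxA mxE (le_trans (ler_norm_sum _ _ _)) // mulr_suml ler_sum // => i _.
rewrite !mxE normrM norm_conjC mulr_suml.
rewrite (le_trans (ler_wpM2l (normr_ge0 _) (ler_norm_sum _ _ _))) // mulr_sumr.
rewrite ler_sum // => j _; rewrite normrM mulrCA ler_wpM2l //.
have [|] := real_leP (normr_real (x i 0)) (normr_real (x j 0)) => hij.
  by rewrite (le_trans _ (xi j)) // expr2 ler_wpM2r.
by rewrite (le_trans _ (xi i)) // expr2 ler_wpM2l // ltW.
Qed.

(* Conjugating a triangular matrix by [diag (e ^ i)] makes its off-diagonal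
   part arbitrarily small. *)
Lemma stable_dissipative k (L : 'M[C]_k) : stable L ->
  exists (S T : 'M[C]_k), [/\ S \in unitmx, S *m L = T *m S & hpd (- (T^t* + T))].
Proof.
case: k L => [|k] L sL.
  exists 1%:M, L; split; rewrite ?unitmx1 ?mulmx1 ?mul1mx // => x.
  by rewrite flatmx0 eqxx.
have [P Pu] := @Schur C _ L isT => PT.
have Pun := unitarymx_unit Pu.
have [T Tt PL] : exists2 T, is_trig_mx T & P *m L = T *m P.
  by exists (conjmx P L); rewrite // conjumx // mulmxKV.
have T0 (i j : 'I_k.+1) : (i < j)%N -> T i j = 0 by move=> ij; rewrite (is_trig_mxP Tt).
have sT i : 'Re (T i i) < 0.
  have : eigenvalue T (T i i).
    rewrite eigenvalue_root_char char_poly_trig // -(big_map (fun i => T i i) xpredT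
      (fun a => 'X - a%:P)) root_prod_XsubC.
    by apply: map_f; rewrite mem_index_enum.
  case/eigenvalue_colP => v hv v0; apply: (sL _ (invmx P *m v)).
    by apply: contra v0 => /eqP e; rewrite -(mulKVmx Pun v) e mulmx0.
  by rewrite -(mulKmx Pun (L *m _)) [P *m _]mulmxA PL -mulmxA mulKVmx // hv linearZ.
pose f i := - ((T i i)^* + T i i).
have f0 i : 0 < f i.
  have := sT i; rewrite /f ReE; set a := T i i => h.
  by rewrite oppr_gt0 addrC; move: h; rewrite pmulr_llt0 // invr_gt0.
(* A positive lower bound of all the [f i]: each inverse is at most the sum of the inverses. *)
pose eta := (1 + \sum_i (f i)^-1)^-1.
have sf0 : 0 <= \sum_i (f i)^-1 by apply: sumr_ge0 => i _; rewrite invr_ge0 ltW.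
have e0 : 0 < eta by rewrite invr_gt0 ltr_wpDr.
have ef i : eta <= f i.
  rewrite /eta -[leRHS]invrK lef_pV2 ?posrE ?invr_gt0 ?ltr_wpDr //.
  rewrite (bigD1 i) //= addrCA lerDl addr_ge0 //.
  by apply: sumr_ge0 => j _; rewrite invr_ge0 ltW.
pose c := \sum_i \sum_j `|T i j|.
have c0 : 0 <= c by apply: sumr_ge0 => i _; apply: sumr_ge0.
(* At most 1, so that positive powers of [e] are at most [e], and so small that the off-diagonal
   part [O], whose entries have absolute sum at most [e * c], contributes less than [eta]. *)
pose e := eta / (eta + 2 * c + 1).
have c2 : 0 <= 2 * c by rewrite mulr_ge0.
have den0 : 0 < eta + 2 * c + 1 by rewrite addr_gt0 // ltr_wpDr.
have ep : 0 < e by rewrite divr_gt0.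
have e1 : e <= 1 by rewrite ler_pdivrMr // mul1r -addrA lerDl addr_ge0.
have ec : 2 * (e * c) < eta.
  have -> : 2 * (e * c) = eta * (2 * c) / (eta + 2 * c + 1) by rewrite /e; ring.
  rewrite ltr_pdivrMr // -subr_gt0.
  have -> : eta * (eta + 2 * c + 1) - eta * (2 * c) = eta * (eta + 1) by ring.
  by rewrite mulr_gt0 // addr_gt0.
(* The exponent is a truncated subtraction: it is 0 above the diagonal, where [T] vanishes. *)
pose T' : 'M[C]_k.+1 := \matrix_(i, j) (e ^+ (i - j) * T i j).
pose O : 'M[C]_k.+1 := \matrix_(i, j) (if i == j then 0 else T' i j).
pose E := diag_mx (\row_i e ^+ i : 'rV[C]_k.+1).
have Eu : E \in unitmx.
  rewrite unitmxE det_diag unitfE; apply/prodf_neq0 => i _.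
  by rewrite mxE expf_neq0 // gt_eqF.
exists (E *m P), T'; split.
- by rewrite unitmx_mul Eu.
- rewrite -mulmxA PL !mulmxA; congr (_ *m _).
  apply/matrixP => i j; rewrite mul_diag_mx mul_mx_diag !mxE.
  have [lt|le] := ltnP i j; first by rewrite T0 // !(mulr0, mul0r).
  by rewrite mulrAC -exprD subnK.
have Oc : \sum_i \sum_j `|O i j| <= e * c.
  rewrite mulr_sumr ler_sum // => i _; rewrite mulr_sumr ler_sum // => j _.
  rewrite !mxE; case: eqVneq => [_|ne]; first by rewrite normr0 mulr_ge0 // ltW.
  have [lt|lt|/val_inj ij] := ltngtP i j; last by rewrite ij eqxx in ne.
    by rewrite T0 // mulr0 normr0 mulr0.
  rewrite normrM ger0_norm ?exprn_ge0 ?(ltW ep) // ler_wpM2r //.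
  by rewrite -[leRHS]expr1 ler_wiXn2l ?(ltW ep) // subn_gt0.
move=> x x0.
have -> : - (T'^t* + T') = diag_mx (\row_i f i) - (O^t* + O).
  apply/matrixP => i j; rewrite !mxE eq_sym; case: eqVneq => [->|ne].
    by rewrite subnn expr0 !mul1r /= rmorph0 addr0 subr0 mulr1n.
  by rewrite /= mulr0n add0r.
rewrite mulmxBr mulmxBl mulmxDr mulmxDl mxDE mxNE mxDE.
have xx := dot_gt0 x0.
have b1 : eta * (x^t* *m x) 0 0 <= (x^t* *m diag_mx (\row_i f i) *m x) 0 0.
  rewrite -mulmxA mul_diag_mx [leLHS]mulrC mxE [leRHS]mxE mulr_suml ler_sum // => i _.
  by rewrite !mxE mulrCA [leLHS]mulrC ler_wpM2r // mulrC -normCK exprn_ge0.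
have b2 := form_norm_le O x.
have -> : (x^t* *m O^t* *m x) 0 0 = ((x^t* *m O *m x) 0 0)^*.
  have -> : x^t* *m O^t* *m x = (x^t* *m O *m x)^t* by rewrite !trmxCE mulmxA.
  by rewrite 2!mxE.
set o := (x^t* *m O *m x) 0 0 in b2 *.
have o2 : o^* + o <= 2 * (e * c) * (x^t* *m x) 0 0.
  have -> : o^* + o = 2 * 'Re o by rewrite ReE; field.
  rewrite -mulrA ler_wpM2l // (le_trans (leif_Re_Creal o)) //.
  by rewrite (le_trans b2) // ler_wpM2r // dot_ge0.
rewrite subr_gt0 (le_lt_trans o2) // (lt_le_trans _ b1) // ltr_pM2r //.
Qed.

(** In the coordinates of [stable_dissipative], the Lyapunov form at an eigenvector of [Y] is the
    eigenvalue times a positive number, so every eigenvalue is nonnegative. *)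
Lemma lyapunov_psd k (L Z : 'M[C]_k) : stable L -> Z^t* = Z ->
  hpsd (- (L^t* *m Z + Z *m L)) -> hpsd Z.
Proof.
move=> /stable_dissipative[S [T [Su SL dT]]] hZ hL.
pose W := invmx S; pose Y := W^t* *m Z *m W.
have eZ : Z = S^t* *m Y *m S.
  rewrite /Y !mulmxA -trmxCM /W mulVmx // trmxC1 mul1mx -mulmxA mulVmx // mulmx1.
  by [].
have hY : Y^t* = Y by rewrite /Y !trmxCE hZ mulmxA.
suff pY : hpsd Y by rewrite eZ; exact: hpsd_congr.
have LW : L *m W = W *m T.
  by rewrite -[LHS](mulKmx Su) [S *m _]mulmxA SL -mulmxA mulmxV // mulmx1.
have eqY : W^t* *m (- (L^t* *m Z + Z *m L)) *m W = - (T^t* *m Y + Y *m T).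
  have LW' : W^t* *m L^t* = T^t* *m W^t* by rewrite -!trmxCM LW.
  rewrite /Y mulmxN mulNmx mulmxDr mulmxDl !mulmxA LW'.
  by rewrite -[_ *m L *m W]mulmxA LW !mulmxA.
have := hpsd_congr W hL; rewrite eqY => {}hL; clearbody Y.
apply: (herm_psd_eigen hY) => z v v0 zr hv.
have := hL v; have := dT v v0.
have e1 : v^t* *m Y = z *: v^t*.
  by rewrite -hY -trmxCM hv trmxCZ (CrealP zr).
have -> : v^t* *m - (T^t* *m Y + Y *m T) *m v = z *: (v^t* *m - (T^t* + T) *m v).
  rewrite mulmxN mulNmx mulmxDr mulmxDl !mulmxA e1 -[_ *m Y *m v]mulmxA hv.
  by mx_norm; ring.
by move=> p0; rewrite mxZE pmulr_lge0.
Qed.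

(** One diagonalization serves all polynomials: ['X] gives [Z] itself, an interpolating polynomial
    its square root. *)
Lemma hpsd_spectral k (Z : 'M[C]_k.+1) : Z^t* = Z -> hpsd Z ->
  exists (P : 'M[C]_k.+1) (d : 'rV_k.+1), [/\ P *m P^t* = 1%:M, forall i, 0 <= d 0 i
    & forall p, horner_mx Z p = P^t* *m diag_mx (map_mx (horner p) d) *m P].
Proof.
move=> hZ pZ.
have Zh : Z \is hermsymmx by apply/is_hermitianmxP; rewrite expr0 scale1r hZ.
have /orthomx_spectralP := hermitian_normalmx Zh.
have Pu := spectral_unitarymx Z.
move: (spectralmx _) (spectral_diag _) Pu => P d Pu eZ.
have PP : P *m P^t* = 1%:M by apply/unitarymxP.
have Pun := unitarymx_unit Pu.
exists P, d; split=> // [i|p].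
  have := pZ (P^t* *m delta_mx i 0).
  rewrite eZ invmx_unitary // trmxCM trmxCK !mulmxA -[_ *m P *m P^t*]mulmxA PP mulmx1.
  rewrite -[_ *m P *m P^t*]mulmxA PP mulmx1.
  by rewrite trmx_delta map_delta_mx -rowE -colE !mxE eqxx.
have -> : Z = conjmx (invmx P) (diag_mx d) by rewrite conjVmx.
rewrite horner_mx_conj ?row_free_unit ?unitmx_inv ?stablemx_unit ?unitmx_inv //.
by rewrite conjVmx // invmx_unitary // horner_mx_diag.
Qed.

Lemma gram_diag k (P : 'M[C]_k) (d : 'rV_k) : P *m P^t* = 1%:M ->
  (forall i, d 0 i \is Num.real) ->
  let S := P^t* *m diag_mx d *m P in
  S^t* = S /\ S *m S = P^t* *m diag_mx (map_mx (fun x => x ^+ 2) d) *m P.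
Proof.
move=> PP dr S; split.
  rewrite !trmxCE mulmxA; congr (_ *m _ *m _).
  rewrite tr_diag_mx map_diag_mx; congr diag_mx.
  by apply/matrixP => i j; rewrite !mxE ord1; apply/CrealP.
rewrite /S !mulmxA -[_ *m P *m P^t*]mulmxA PP mulmx1.
congr (_ *m _); rewrite -mulmxA mulmx_diag; congr (_ *m diag_mx _).
by apply/matrixP => i j; rewrite !mxE ord1.
Qed.

End Lyapunov.

(** * Hamiltonian matrices and Riccati equations *)

Section Hamiltonian.
Variable C : numClosedFieldType.

(** [R] is a basis of the kernel of [p] at [g], and [L] is the matrix of [g] on it. An eigenvector
    [w] of [L] gives the eigenvector [w *m R] of [g], which [p] at [g] kills. *)
Lemma kermxpoly_invariant n (g : 'M[C]_n) (p : {poly C}) :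
  exists (R : 'M[C]_(\rank (kermxpoly g p), n)) L,
    [/\ row_free R, R *m g = L *m R & forall z, eigenvalue L z -> root p z /\ eigenvalue g z].
Proof.
case: n g => [|n] g.
  exists (row_base (kermxpoly g p)), 0; split; first exact: row_base_free.
    by rewrite mul0mx; apply/matrixP => i [].
  move=> z /eigenvalueP[w _ /eqP[]]; apply/matrixP => i j.
  by have := ltn_ord j; rewrite {2}thinmx0 mxrank0.
set W := kermxpoly g p.
have Wg : stablemx W g by apply: comm_mx_stable_kermxpoly; apply: comm_mx_refl.
have RL : row_base W *m g = conjmx (row_base W) g *m row_base W.
  by rewrite /conjmx mulmxKpV // stablemx_row_base.
exists (row_base W), (conjmx (row_base W) g); split => //; first exact: row_base_free.
move=> z ez; split; last first.
  by apply: (eigenvalue_conjmx _ _ ez); rewrite ?stablemx_row_base ?row_base_free.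
have [w hw w0] := eigenvalueP ez.
have ww0 : w *m row_base W != 0.
  by apply: contra w0; rewrite mulmx_free_eq0 ?row_base_free.
have eg : w *m row_base W *m g = z *: (w *m row_base W).
  by rewrite -mulmxA RL mulmxA hw scalemxAl.
have : w *m row_base W *m horner_mx g p = p.[z] *: (w *m row_base W).
  move: (w *m _) eg => u eg; elim/poly_ind: p {W Wg RL ez w hw w0 ww0} => [|q c IH].
    by rewrite rmorph0 mulmx0 horner0 scale0r.
  rewrite rmorphD rmorphM /= horner_mx_X horner_mx_C mulmxDr -mulmxE mulmxA IH.
  by rewrite -scalemxAl eg mul_mx_scalar scalerA -scalerDl hornerMXaddC.
have -> : w *m row_base W *m horner_mx g p = 0.
  apply/eqP; have : (w *m row_base W <= W)%MS.
    by rewrite (submx_trans (submxMl _ _)) // eq_row_base.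
  by move/sub_kermxP => ->.
by move=> /esym/eqP; rewrite scaler_eq0 (negbTE ww0) orbF.
Qed.

(** The characteristic polynomial splits into coprime factors by the sign of the real part of the
    roots. Their kernels are in direct sum and, by Cayley-Hamilton, span the space. *)
Lemma spectral_splitting n (g : 'M[C]_n) :
  (forall z, eigenvalue g z -> 'Re z != 0) ->
  exists r s (U : 'M[C]_(r, n)) (V : 'M[C]_(s, n)) (L : 'M[C]_r) (M : 'M[C]_s),
  [/\ (r + s = n)%N, row_free U /\ row_free V, U *m g = L *m U /\ V *m g = M *m V,
      stable L & stable (- M)].
Proof.
case: n g => [|n] g hg.
  exists 0%N, 0%N, 0, 0, 0, 0; split=> //; try (split; exact: row_free0).
  - by rewrite /row_free !mxrank0.
  - by rewrite !flatmx0.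
  - by move=> z v; rewrite flatmx0 eqxx.
  - by move=> z v; rewrite flatmx0 eqxx.
have [rs ers] := closed_field_poly_normal (char_poly g).
rewrite (monicP (char_poly_monic g)) scale1r in ers.
pose p := \prod_(z <- rs | 'Re z < 0) ('X - z%:P).
pose q := \prod_(z <- rs | ~~ ('Re z < 0)) ('X - z%:P).
have rp z : root p z -> 'Re z < 0.
  rewrite /p -big_filter root_prod_XsubC mem_filter => /andP[] //.
have rq z : root q z -> ~~ ('Re z < 0).
  rewrite /q -big_filter root_prod_XsubC mem_filter => /andP[] //.
have pq : char_poly g = p * q by rewrite ers (bigID (fun z => 'Re z < 0)).
have cpq : coprimep p q.
  apply: Pdiv.ClosedField.root_coprimep => z pz; apply/negP => /rq.
  by rewrite rp.
have W1 : (kermxpoly g p + kermxpoly g q :=: 1%:M)%MS.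
  apply: eqmx_trans (eqmx_sym (kermxpolyM g cpq)) _.
  by rewrite -pq /kermxpoly Cayley_Hamilton; exact: kermx0.
have dW := mxdirect_kermxpoly g cpq.
have [U [L [fU UL eL]]] := kermxpoly_invariant g p.
have [V [M [fV VM eM]]] := kermxpoly_invariant g q.
exists (\rank (kermxpoly g p)), (\rank (kermxpoly g q)), U, V, L, M; split=> //.
- have := mxrank_sum_cap (kermxpoly g p) (kermxpoly g q).
  by rewrite dW mxrank0 addn0 W1 mxrank1 => /esym.
- by apply/stableP => z /eL[/rp].
move=> z v v0 hv.
have : eigenvalue M (- z).
  apply/eigenvalue_colP; exists v => //; apply: (can_inj (@opprK _)).
  by rewrite -mulNmx hv scaleNr opprK.
case/eM => /rq; rewrite -real_leNgt ?Creal_Re // => h /hg h0.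
have : 0 < 'Re (- z) by rewrite lt_def h0.
by rewrite raddfN oppr_gt0.
Qed.

Lemma row_free_tr_inj r n (U : 'M[C]_(r, n)) (v : 'cV_r) :
  row_free U -> U^T *m v = 0 -> v = 0.
Proof.
move=> fU h; apply/eqP; rewrite -trmx_eq0 -(mulmx_free_eq0 _ fU).
by rewrite -[U]trmxK -trmx_mul h trmx0.
Qed.

(* The symplectic form [x^t* *m J *m y] vanishes on both spectral subspaces of
   [H], so neither exceeds half of the dimension. *)
Lemma hamiltonian_subspace m (A N Q : 'M[C]_m) : N^t* = N -> Q^t* = Q ->
  (forall z (x y : 'cV_m), 'Re z = 0 -> A *m x - N *m y = z *: x ->
     - (Q *m x) - A^t* *m y = z *: y -> x = 0 /\ y = 0) ->
  exists X1 X2 L : 'M[C]_m,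
    [/\ stable L, A *m X1 - N *m X2 = X1 *m L,
        - (Q *m X1) - A^t* *m X2 = X2 *m L, X1^t* *m X2 = X2^t* *m X1
      & forall v : 'cV_m, X1 *m v = 0 -> X2 *m v = 0 -> v = 0].
Proof.
move=> hN hQ him.
pose H := block_mx A (- N) (- Q) (- A^t*).
pose J : 'M[C]_(m + m) := block_mx 0 1%:M (- 1%:M) 0.
have JJ : J *m (- J) = 1%:M.
  rewrite /J -[- block_mx _ _ _ _]scaleN1r scale_block_mx mulmx_block scalar_mx_block.
  by congr block_mx; mx_norm; ring.
have Ju : J \in unitmx by case/mulmx1_unit: JJ.
have HJ : H^t* *m J = - (J *m H).
  rewrite /J /H tr_block_mx map_block_mx -[- (_ *m _)]scaleN1r !mulmx_block scale_block_mx.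
  by rewrite !trmxCE hN hQ; congr block_mx; mx_norm; ring.
(* The splitting yields row spaces, so it is applied to the transpose; [U^T] and [V^T] then span
   column spaces invariant under [H]. *)
have [z /eigenvalueP[w hw w0]|r [s [U [V [L [M [rs [fU fV] [UL VM] sL sM]]]]]]]
    := @spectral_splitting _ H^T.
  apply/eqP => z0; move: w0; rewrite -trmx_eq0.
  have : H *m w^T = z *: w^T by rewrite -[H]trmxK -trmx_mul hw linearZ.
  rewrite -[w^T]vsubmxK; move: (usubmx _) (dsubmx _) => x y.
  rewrite mul_block_col scale_col_mx !mulNmx => /eq_col_mx[e1 e2].
  by have [-> ->] := him z x y z0 e1 e2; rewrite col_mx0 eqxx.
have HU : H *m U^T = U^T *m L^T by rewrite -[H]trmxK -!trmx_mul UL.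
have HV : H *m V^T = V^T *m M^T by rewrite -[H]trmxK -!trmx_mul VM.
have isotropic k (W : 'M[C]_(k, m + m)) S : row_free W -> H *m W^T = W^T *m S ->
    stable S \/ stable (- S) -> (k + k <= m + m)%N /\ (W^T)^t* *m J *m W^T = 0.
  move=> fW HW sS; set K := (W^T)^t* *m J *m W^T.
  (* [J] turns [H] into minus its adjoint, so the restricted form solves a homogeneous Sylvester
     equation. *)
  have E : S^t* *m K + K *m S = 0.
    have -> : K *m S = (W^T)^t* *m (J *m H) *m W^T by rewrite /K -!mulmxA HW.
    have -> : S^t* *m K = (W^T)^t* *m (H^t* *m J) *m W^T.
      by rewrite /K !mulmxA -!trmxCM HW.
    by rewrite HJ; mx_norm; ring.
  have K0 : K = 0.
    case: sS => sS; first exact: sylvester E.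
    apply: (sylvester sS sS); rewrite trmxCN mulNmx mulmxN -opprD E oppr0.
    by [].
  split; last exact: K0.
  have := mulmx0_rank_max K0; rewrite mxrank_tr (eqP fW) mxrankMfree.
    by rewrite mxrank_map !mxrank_tr (eqP fW).
  by rewrite row_free_unit.
have [r2 K0] := isotropic _ _ _ fU HU (or_introl (stable_tr sL)).
have [s2 _] : (s + s <= m + m)%N /\ (V^T)^t* *m J *m V^T = 0.
  apply: (isotropic _ _ _ fV HV); right.
  by rewrite -linearN; exact: stable_tr.
(* Both dimensions are at most [m], and they add up to [m + m]. *)
have rm : r = m by lia.
move: U L fU UL HU sL K0 {r2 rs}; rewrite rm => U L fU UL HU sL K0.
have inj v := row_free_tr_inj (v := v) fU.
have [X1 [X2 eU]] : exists X1 X2, U^T = col_mx X1 X2 :> 'M[C]_(m + m, m).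
  by exists (usubmx U^T), (dsubmx U^T); rewrite vsubmxK.
rewrite eU in HU K0 inj; exists X1, X2, L^T; move: HU K0.
rewrite mul_block_col mul_col_mx !mulNmx => /eq_col_mx[e1 e2].
rewrite tr_col_mx map_row_mx mul_row_block mul_row_col.
rewrite !(mulmx0, mulmx1, mulmxN, mulNmx, add0r, addr0).
move=> /eqP; rewrite addrC subr_eq0 => /eqP e3; split=> //; first exact: stable_tr.
by move=> v h1 h2; apply: inj; rewrite mul_col_mx h1 h2 col_mx0.
Qed.

End Hamiltonian.

(** * Riccati solutions from stable Hamiltonian subspaces *)

Section Riccati.
Variable C : numClosedFieldType.

Lemma col_inj_unitmx k (X : 'M[C]_k) :
  (forall v : 'cV_k, X *m v = 0 -> v = 0) -> X \in unitmx.
Proof.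
move=> h; rewrite -unitmx_tr -row_free_unit -kermx_eq0; apply/rowV0P => v.
move/sub_kermxP => hv; apply/eqP; rewrite -trmx_eq0; apply/eqP/h.
by rewrite -[X]trmxK -trmx_mul hv trmx0.
Qed.

Lemma hpd_unitmx k (Z : 'M[C]_k) : hpd Z -> Z \in unitmx.
Proof.
move=> h; apply: col_inj_unitmx => v hv; apply/eqP; apply: contraT => /h.
by rewrite -mulmxA hv mulmx0 mxE ltxx.
Qed.

Definition riccati m (A N Q P : 'M[C]_m) := A^t* *m P + P *m A + Q - P *m N *m P.

(** Subtracting the equations gives a Sylvester equation for [P1 - P2] whose coefficients are the
    two stable closed loops. *)
Lemma riccati_unique m (A N Q P1 P2 : 'M[C]_m) :
  N^t* = N -> P1^t* = P1 -> riccati A N Q P1 = 0 -> riccati A N Q P2 = 0 ->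
  stable (A - N *m P1) -> stable (A - N *m P2) -> P1 = P2.
Proof.
move=> hN h1 r1 r2 s1 s2; apply/eqP; rewrite -subr_eq0; apply/eqP.
apply: (sylvester s1 s2); rewrite !trmxCE hN h1.
have : riccati A N Q P1 - riccati A N Q P2 = 0 by rewrite r1 r2 subr0.
by move=> <-; rewrite /riccati; mx_norm; ring.
Qed.

(** The subspace is the graph of [P]. Isotropy makes [P] Hermitian, the second block row becomes the
    Riccati equation, and [A - N *m P] is similar to [L]. *)
Lemma hamiltonian_graph m (A N Q X1 X2 L : 'M[C]_m) :
  X1 \in unitmx -> stable L ->
  A *m X1 - N *m X2 = X1 *m L -> - (Q *m X1) - A^t* *m X2 = X2 *m L ->
  X1^t* *m X2 = X2^t* *m X1 ->
  exists P, [/\ P *m X1 = X2, P^t* = P, riccati A N Q P = 0 & stable (A - N *m P)].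
Proof.
move=> u sL e1 e2 e3; pose P := X2 *m invmx X1.
have PX : P *m X1 = X2 by rewrite mulmxKV.
clearbody P; exists P; split=> //.
- apply/eqP; rewrite -subr_eq0; apply/eqP.
  have : X1^t* *m (P^t* - P) *m X1 = 0.
    by rewrite mulmxBr mulmxBl -trmxCM PX -mulmxA PX e3 subrr.
  move/(congr1 (fun Z => invmx (X1^t*) *m Z *m invmx X1)).
  by rewrite mulmx0 mul0mx !mulmxA mulVmx ?unitmx_trmxC // mul1mx mulmxK.
- have : riccati A N Q P *m X1 = 0.
    rewrite /riccati mulmxBl !mulmxDl -!mulmxA PX.
    have -> : A *m X1 = X1 *m L + N *m X2 by rewrite -e1 subrK.
    have -> : A^t* *m X2 = - (Q *m X1) - X2 *m L by rewrite -e2 opprB addrCA subrr addr0.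
    by rewrite mulmxDr !mulmxA PX; mx_norm; ring.
  by move/(congr1 (mulmx^~ (invmx X1))); rewrite mul0mx mulmxK.
- move=> z v v0 hv; apply: (sL z (invmx X1 *m v)).
    by apply: contra v0 => /eqP e; rewrite -(mulKVmx u v) e mulmx0.
  rewrite -(mulKmx u (L *m _)) [X1 *m _]mulmxA -e1 -PX.
  have -> : A *m X1 - N *m (P *m X1) = (A - N *m P) *m X1 by mx_norm; ring.
  by rewrite -mulmxA mulKVmx // hv linearZ.
Qed.

(* In terms of [Y = P0^-1] the form [Z] below is nonnegative on the stable
   subspace by Lyapunov, and it is [- (X2 v)^t* Y (X2 v)] when [X1 v = 0]. *)
Lemma riccati_comparison m (A N Q P0 : 'M[C]_m) :
  N^t* = N -> Q^t* = Q -> hpsd Q ->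
  (forall z (v : 'cV_m), v != 0 -> A *m v = z *: v -> Q *m v = 0 -> 'Re z < 0) ->
  P0^t* = P0 -> hpd P0 -> hpd (- riccati A N Q P0) ->
  exists P, [/\ P^t* = P, hpsd P, hpsd (P0 - P), riccati A N Q P = 0
              & stable (A - N *m P)].
Proof.
move=> hN hQ pQ det h0 p0 pF; set F := riccati A N Q P0 in pF.
have u0 := hpd_unitmx p0.
pose Y := invmx P0.
have hY : Y^t* = Y by rewrite trmxCV h0.
have YP : Y *m P0 = 1%:M by rewrite mulVmx.
have PY : P0 *m Y = 1%:M by rewrite mulmxV.
have YFY : Y *m F *m Y = Y *m A^t* + A *m Y + Y *m Q *m Y - N.
  rewrite /F /riccati mulmxBr mulmxBl !(mulmxDl, mulmxDr) !mulmxA YP mul1mx.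
  by rewrite -[_ *m P0 *m Y]mulmxA PY mulmx1 -[_ *m P0 *m Y]mulmxA PY mulmx1 mul1mx.
have pY : hpd Y.
  move=> v v0; have w0 : Y *m v != 0.
    by apply: contra v0 => /eqP e; rewrite -(mul1mx v) -PY -mulmxA e mulmx0.
  by have := p0 _ w0; rewrite trmxCM hY !mulmxA -[_ *m Y *m P0]mulmxA YP mulmx1.
clearbody Y; clearbody F.
have im z (x y : 'cV_m) : 'Re z = 0 -> A *m x - N *m y = z *: x ->
     - (Q *m x) - A^t* *m y = z *: y -> x = 0 /\ y = 0.
  move=> z0 e1 e2.
  have zc : z^* = - z.
    apply/eqP; rewrite -subr_eq0 opprK addrC; apply/eqP.
    by move: z0; rewrite ReE => /eqP; rewrite mulf_eq0 invr_eq0 pnatr_eq0 orbF => /eqP.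
  have ey : A^t* *m y = - (Q *m x) - z *: y by rewrite -e2 opprB addrCA subrr addr0.
  have eyt : y^t* *m A = - (x^t* *m Q) + z *: y^t*.
    by have := congr1 (fun Z => Z^t*) ey; rewrite !trmxCE hQ zc scaleNr opprK.
  have eN : N *m y = A *m x - z *: x by rewrite -e1 opprB addrCA subrr addr0.
  (* For nonzero [y] the left side is negative, as [F] is, while the right side is nonnegative; so
     [y = 0]. Then a nonzero [x] would be an imaginary mode of [A] killed by [Q], against [det]. *)
  have id : y^t* *m (Y *m F *m Y) *m y = (x - Y *m y)^t* *m Q *m (x - Y *m y).
    rewrite YFY mulmxBr mulmxBl !(mulmxDl, mulmxDr) -!mulmxA eN ey.
    mx_expand; rewrite !eyt !trmxCE hY.
    by mx_norm; ring.
  have y0 : y = 0.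
    apply/eqP; apply: contraT => y0.
    have w0 : Y *m y != 0.
      by apply: contra y0 => /eqP e; rewrite -(mul1mx y) -PY -mulmxA e mulmx0.
    have := pF _ w0; have := pQ (x - Y *m y); rewrite -id trmxCM hY !mulmxA.
    by rewrite mulmxN !mulNmx mxNE oppr_gt0 => a /(le_lt_trans a); rewrite ltxx.
  split=> //; apply/eqP; apply: contraT => x0.
  have : 'Re z < 0.
    apply: (det z x x0); first by rewrite -e1 y0 mulmx0 subr0.
    by apply/eqP; rewrite -oppr_eq0; move: e2; rewrite y0 mulmx0 subr0 scaler0 => ->.
  by rewrite z0 ltxx.
have [X1 [X2 [L [sL e1 e2 e3 inj]]]] := hamiltonian_subspace hN hQ im.
pose Z := X1^t* *m X2 - X2^t* *m Y *m X2.
have hZ : Z^t* = Z by rewrite /Z !trmxCE hY e3 mulmxA.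
have pZ : hpsd Z.
  apply: (lyapunov_psd sL hZ).
  have e1t : L^t* *m X2^t* = - (X1^t* *m Q) - X2^t* *m A.
    by rewrite -trmxCM -e2 !trmxCE hQ.
  have -> : - (L^t* *m Z + Z *m L)
      = (X1 - Y *m X2)^t* *m Q *m (X1 - Y *m X2) + (Y *m X2)^t* *m (- F) *m (Y *m X2).
    have -> : (Y *m X2)^t* *m (- F) *m (Y *m X2) = - (X2^t* *m (Y *m F *m Y) *m X2).
      by rewrite trmxCM hY; mx_norm; ring.
    have -> : Z *m L = X2^t* *m (A *m X1 - N *m X2)
                       - X2^t* *m Y *m (- (Q *m X1) - A^t* *m X2).
      by rewrite /Z e3 mulmxBl e1 e2 !mulmxA.
    have -> : L^t* *m Z = (- (X1^t* *m Q) - X2^t* *m A) *m X1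
                          - (- (X1^t* *m Q) - X2^t* *m A) *m Y *m X2.
      by rewrite /Z e3 mulmxBr !mulmxA e1t.
    rewrite YFY !trmxCE hY.
    by mx_norm; ring.
  by apply: hpsdD; apply: hpsd_congr => //; exact: hpd_psd.
have u1 : X1 \in unitmx.
  apply: col_inj_unitmx => v hv; apply: (inj _ hv); apply/eqP; apply: contraT => w0.
  have := pZ v; have := pY _ w0.
  have -> : v^t* *m Z *m v = - ((X2 *m v)^t* *m Y *m (X2 *m v)).
    rewrite /Z mulmxBr mulmxBl !mulmxA -trmxCM hv trmxC0 !mul0mx trmxCM.
    by mx_norm; ring.
  by rewrite mxNE oppr_ge0 => a /(lt_le_trans a); rewrite ltxx.
have [P [PX hP rP sP]] := hamiltonian_graph u1 sL e1 e2 e3.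
have pPY : hpsd (P - P *m Y *m P).
  have -> : P - P *m Y *m P = (invmx X1)^t* *m Z *m invmx X1.
    have eX : X2 *m invmx X1 = P by rewrite -PX mulmxK.
    rewrite /Z mulmxBr mulmxBl !mulmxA -!trmxCM -[_ *m X2 *m _]mulmxA eX.
    by rewrite mulmxV // trmxC1 mul1mx -[_ *m X2 *m _]mulmxA !eX hP.
  exact: hpsd_congr.
exists P; split=> //.
- have -> : P = (P - P *m Y *m P) + P^t* *m Y *m P by rewrite hP subrK.
  apply: hpsdD => //; apply: hpsd_congr; exact: hpd_psd.
(* Completing the square, with [Y] inverse to [P0]. *)
- have -> : P0 - P = (P - P *m Y *m P) + (1%:M - Y *m P)^t* *m P0 *m (1%:M - Y *m P).
    rewrite !trmxCE hY hP; mx_expand.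
    by rewrite PY -[P *m Y *m P0]mulmxA YP; mx_norm; ring.
  by apply: hpsdD => //; apply: hpsd_congr; exact: hpd_psd.
Qed.

(** If [X1] kills [w], isotropy forces [D^t* *m X2 *m w = 0], so the kernel of [X1] is invariant
    under [L]. There [A^t* *m X2 + X2 *m L] vanishes, and a Sylvester argument makes [X2] vanish
    too; hence [X1] is invertible. *)
Lemma bounded_real m n (A Q : 'M[C]_m) (D : 'M[C]_(m, n)) :
  Q^t* = Q -> hpsd Q -> stable A ->
  (forall z (x y : 'cV_m), 'Re z = 0 -> A *m x + D *m D^t* *m y = z *: x ->
     - (Q *m x) - A^t* *m y = z *: y -> x = 0 /\ y = 0) ->
  exists P, [/\ P^t* = P, hpsd P, riccati A (- (D *m D^t*)) Q P = 0
              & stable (A - (- (D *m D^t*)) *m P)].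
Proof.
move=> hQ pQ sA im; set N := - (D *m D^t*).
have hN : N^t* = N by rewrite /N !trmxCE.
have im' z (x y : 'cV_m) : 'Re z = 0 -> A *m x - N *m y = z *: x ->
     - (Q *m x) - A^t* *m y = z *: y -> x = 0 /\ y = 0.
  by rewrite /N mulNmx opprK; exact: im.
have [X1 [X2 [L [sL e1 e2 e3 inj]]]] := hamiltonian_subspace hN hQ im'.
have kerL (w : 'cV_m) : X1 *m w = 0 -> X1 *m (L *m w) = 0.
  move=> hw.
  have e : X1 *m (L *m w) = D *m (D^t* *m (X2 *m w)).
    by rewrite mulmxA -e1 mulmxBl -!mulmxA hw mulmx0 sub0r /N mulNmx opprK !mulmxA.
  rewrite e; suff -> : D^t* *m (X2 *m w) = 0 by rewrite mulmx0.
  apply/eqP; apply: contraT => /dot_gt0.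
  rewrite !trmxCE -!mulmxA -e !mulmxA -[_ *m X2^t* *m X1]mulmxA -e3 !mulmxA.
  by rewrite -trmxCM hw trmxC0 !mul0mx mxE ltxx.
have u1 : X1 \in unitmx.
  apply: col_inj_unitmx => v hv; apply: (inj _ hv).
  have hk k : X1 *m (L ^+ k *m v) = 0.
    elim: k => [|k IH]; first by rewrite expr0 mul1mx.
    by rewrite exprS -mulmxE -mulmxA kerL.
  apply: (sylvester_krylov sA sL) => k.
  have -> : L ^+ k.+1 *m v = L *m (L ^+ k *m v) by rewrite exprS -mulmxE -mulmxA.
  rewrite [X2 *m (L *m _)]mulmxA -e2 mulmxBl mulNmx -[Q *m X1 *m _]mulmxA hk mulmx0.
  by rewrite oppr0 sub0r addrN.
have [P [PX hP rP sP]] := hamiltonian_graph u1 sL e1 e2 e3.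
exists P; split=> //; apply: (lyapunov_psd sA hP).
have -> : - (A^t* *m P + P *m A) = Q + (D^t* *m P)^t* *m (D^t* *m P).
  rewrite -[LHS]add0r -rP /riccati /N !trmxCE hP.
  by mx_norm; ring.
by apply: hpsdD => //; exact: hpsd_gram.
Qed.

End Riccati.

(** * Frequency responses on the imaginary axis *)

Section FrequencyResponse.
Variable C : numClosedFieldType.

Lemma stable_resolvent m (A : 'M[C]_m) z : stable A -> 'Re z = 0 -> z%:M - A \in unitmx.
Proof.
move=> sA z0; apply: col_inj_unitmx => v; rewrite mulmxBl mul_scalar_mx => /eqP.
rewrite subr_eq0 eq_sym => /eqP hv; apply/eqP; apply: contraT => v0.
by have := sA z v v0 hv; rewrite z0 ltxx.
Qed.

Lemma conj_imag (z : C) : 'Re z = 0 -> z^* = - z.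
Proof.
move=> z0; apply/eqP; rewrite -subr_eq0 opprK addrC; apply/eqP.
by move: z0; rewrite ReE => /eqP; rewrite mulf_eq0 invr_eq0 pnatr_eq0 orbF => /eqP.
Qed.

(** The Gram matrix of the transfer function [Q^(1/2) (z - A)^-1 D], written without the square
    root. *)
Definition response m n (A Q : 'M[C]_m) (D : 'M[C]_(m, n)) z :=
  (invmx (z%:M - A) *m D)^t* *m Q *m (invmx (z%:M - A) *m D).

(** An imaginary eigenvector of the Hamiltonian matrix is determined by [D^t* *m y], which is a
    fixed vector of the response. *)
Lemma response_no_imag m n (A Q : 'M[C]_m) (D : 'M[C]_(m, n)) z (x y : 'cV_m) :
  stable A -> 'Re z = 0 ->
  (forall w : 'cV_n, response A Q D z *m w = w -> w = 0) ->
  A *m x + D *m D^t* *m y = z *: x -> - (Q *m x) - A^t* *m y = z *: y ->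
  x = 0 /\ y = 0.
Proof.
move=> sA z0 h e1 e2; have u := stable_resolvent sA z0.
set V := invmx (z%:M - A).
have ex : x = V *m D *m (D^t* *m y).
  rewrite -[LHS](mulKmx u) -/V -!mulmxA; congr (_ *m _).
  by rewrite mulmxBl mul_scalar_mx -e1 addrAC subrr add0r mulmxA.
have ey : y = V^t* *m (Q *m x).
  have -> : Q *m x = (z%:M - A)^t* *m y.
    have e : Q *m x = - (z *: y) - A^t* *m y by rewrite -e2 opprB opprK addrAC subrr add0r.
    by rewrite e trmxCD trmxCN mulmxDl mulNmx tr_scalar_mx map_scalar_mx /= conj_imag //
      mul_scalar_mx scaleNr.
  by rewrite trmxCV mulKmx // unitmx_trmxC.
have w0 : D^t* *m y = 0.
  have e : D^t* *m y = D^t* *m (V^t* *m (Q *m x)) by rewrite -ey.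
  by apply: h; rewrite [RHS]e ex /response -/V trmxCM !mulmxA.
by split; rewrite ?ey ex w0 !mulmx0.
Qed.

(** A dissipation inequality: the right side minus the left is the assumed nonnegative form at [x]
    plus [k] times the squared norm of [D^t* *m P *m x - k^-1 *: w]. *)
Lemma response_le m n (A Q P : 'M[C]_m) (D : 'M[C]_(m, n)) z k (w : 'cV_n) :
  stable A -> 'Re z = 0 -> P^t* = P -> 0 < k ->
  hpsd (- (A^t* *m P + P *m A + Q + k *: (P *m D *m (D^t* *m P)))) ->
  (w^t* *m response A Q D z *m w) 0 0 <= k^-1 * (w^t* *m w) 0 0.
Proof.
move=> sA z0 hP k0 pP; have u := stable_resolvent sA z0.
pose x := invmx (z%:M - A) *m D *m w.
have hx : A *m x = z *: x - D *m w.
  apply/eqP; rewrite eq_sym subr_eq addrC -subr_eq -mul_scalar_mx -mulmxBl.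
  by rewrite /x -mulmxA mulKVmx.
have -> : w^t* *m response A Q D z *m w = x^t* *m Q *m x.
  by rewrite /response /x !trmxCM !mulmxA.
clearbody x.
have hxt : x^t* *m A^t* = - (z *: x^t*) - w^t* *m D^t*.
  by rewrite -(trmxCM A x) hx !trmxCE conj_imag // scaleNr.
have kr : k^* = k by apply/CrealP; rewrite ger0_real // ltW.
have kc : (k^-1)^* = k^-1 by apply/CrealP; rewrite ger0_real // invr_ge0 ltW.
have kk : k^-1 * k = 1 by rewrite mulVf // gt_eqF.
have := addr_ge0 (pP x) (mulr_ge0 (ltW k0) (dot_ge0 (D^t* *m P *m x - k^-1 *: w))).
rewrite -mxZE -mxDE; set Z := (_ + _); have -> : Z = k^-1 *: (w^t* *m w) - x^t* *m Q *m x.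
  rewrite /Z !trmxCE kc hP; mx_expand.
  rewrite hxt. rewrite -[_ *m A *m x]mulmxA. rewrite hx; mx_expand.
  by mx_norm; field; rewrite gt_eqF.
by rewrite mxDE mxZE mxNE subr_ge0.
Qed.

End FrequencyResponse.

Local Open Scope complex_scope.

(** * Real matrices *)

Section RealMatrices.
Variable R : realType.

Lemma cmxE p q (M : 'M[R]_(p, q)) : cmx M = map_mx (real_complex R) M.
Proof. by []. Qed.

Lemma cmxM p q r (X : 'M[R]_(p, q)) (Y : 'M[R]_(q, r)) : cmx (X *m Y) = cmx X *m cmx Y.
Proof. by rewrite !cmxE map_mxM. Qed.

Lemma cmxD p q (X Y : 'M[R]_(p, q)) : cmx (X + Y) = cmx X + cmx Y.
Proof. by rewrite !cmxE map_mxD. Qed.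

Lemma cmxN p q (X : 'M[R]_(p, q)) : cmx (- X) = - cmx X.
Proof. by rewrite !cmxE map_mxN. Qed.

Lemma cmxZ p q a (X : 'M[R]_(p, q)) : cmx (a *: X) = a%:C *: cmx X.
Proof. by rewrite !cmxE map_mxZ. Qed.

Lemma cmx0 p q : cmx (0 : 'M[R]_(p, q)) = 0.
Proof. by rewrite !cmxE map_mx0. Qed.

Lemma cmx1 p : cmx (1%:M : 'M[R]_p) = 1%:M.
Proof. by rewrite !cmxE map_mx1. Qed.

Lemma cmx_inj p q : injective (@cmx R p q).
Proof. by move=> X Y /matrixP h; apply/matrixP => i j; have := h i j; rewrite !mxE => -[]. Qed.

Lemma conj_real (x : R) : (x%:C)^*%R = x%:C.
Proof. by apply/CrealP; rewrite complex_real. Qed.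

Lemma cmx_trC p q (X : 'M[R]_(p, q)) : (cmx X)^t* = cmx X^T.
Proof. by apply/matrixP => i j; rewrite !mxE conj_real. Qed.

Lemma Re_lt0 (z : R[i]) : ('Re z < 0) = (complex.Re z < 0).
Proof. by rewrite -complexRe ltcR. Qed.

Lemma hurwitzP k (M : 'M[R]_k) : hurwitz M <-> stable (cmx M).
Proof.
by rewrite stableP; split=> h z /h; rewrite Re_lt0.
Qed.

Lemma complex_mxP p q (x : 'M[R[i]]_(p, q)) : exists a b, x = cmx a + 'i *: cmx b.
Proof.
exists (map_mx (@complex.Re R) x), (map_mx (@complex.Im R) x).
by apply/matrixP => i j; rewrite !mxE {1}[x i j]complexE complexiE.
Qed.

Lemma form_complex k (P : 'M[R]_k) (a b : 'cV[R]_k) : P^T = P ->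
  ((cmx a + 'i *: cmx b)^t* *m cmx P *m (cmx a + 'i *: cmx b)) 0 0
  = ((a^T *m P *m a) 0 0 + (b^T *m P *m b) 0 0)%:C.
Proof.
move=> hP.
rewrite form_rect !cmx_trC -!cmxM.
have -> : b^T *m P *m a = a^T *m P *m b.
  have -> : a^T *m P *m b = (b^T *m P *m a)^T by rewrite !trmx_mul trmxK hP mulmxA.
  by apply/matrixP => i j; rewrite !ord1 [RHS]mxE.
by rewrite subrr scaler0 addr0 -cmxD mxE mxDE.
Qed.

Lemma form_real k (P : 'M[R]_k) (x : 'cV[R]_k) :
  ((cmx x)^t* *m cmx P *m cmx x) 0 0 = ((x^T *m P *m x) 0 0)%:C.
Proof. by rewrite cmx_trC -!cmxM mxE. Qed.

Lemma psdP k (P : 'M[R]_k) : psd P <-> P^T = P /\ hpsd (cmx P).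
Proof.
split=> [[hP h]|[hP h]]; split=> // x.
  have [a [b ->]] := complex_mxP x.
  by rewrite form_complex // ler0c addr_ge0.
by have := h (cmx x); rewrite form_real ler0c.
Qed.

Lemma posdefP k (P : 'M[R]_k) : posdef P <-> P^T = P /\ hpd (cmx P).
Proof.
split=> [[hP h]|[hP h]]; split=> // x.
  have [a [b ->]] := complex_mxP x.
  have nn (c : 'cV[R]_k) : 0 <= (c^T *m P *m c) 0 0.
    have [->|/h/ltW//] := eqVneq c 0; by rewrite mulmx0 mxE.
  move=> ab; rewrite form_complex // (ltcR 0).
  have [a0|/h a0] := eqVneq a 0; last by rewrite ltr_wpDr.
  have [b0|/h b0] := eqVneq b 0; last by rewrite ltr_wpDl.
  by rewrite a0 b0 !cmx0 scaler0 addr0 eqxx in ab.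
move=> x0; have := h (cmx x); rewrite form_real (ltcR 0); apply.
apply: contra x0 => /eqP e.
by apply/eqP/cmx_inj; rewrite e cmx0.
Qed.

Lemma posdef_psd k (P : 'M[R]_k) : posdef P -> psd P.
Proof.
move=> [hP h]; split=> // x; have [->|/h/ltW//] := eqVneq x 0.
by rewrite mulmx0 mxE.
Qed.

Lemma psdD k (X Y : 'M[R]_k) : psd X -> psd Y -> psd (X + Y).
Proof.
move=> [hX pX] [hY pY]; split; first by rewrite linearD /= hX hY.
by move=> x; rewrite mulmxDr mulmxDl mxDE addr_ge0.
Qed.

Lemma posdefD k (X Y : 'M[R]_k) : psd X -> posdef Y -> posdef (X + Y).
Proof.
move=> [hX pX] [hY pY]; split; first by rewrite linearD /= hX hY.
by move=> x x0; rewrite mulmxDr mulmxDl mxDE ltr_wpDl // pY.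
Qed.

Lemma psd_congr k l (X : 'M[R]_k) (Y : 'M[R]_(k, l)) : psd X -> psd (Y^T *m X *m Y).
Proof.
move=> [hX pX]; split; first by rewrite !trmx_mul trmxK hX mulmxA.
by move=> x; have := pX (Y *m x); rewrite trmx_mul !mulmxA.
Qed.

Lemma psdZ k a (X : 'M[R]_k) : 0 <= a -> psd X -> psd (a *: X).
Proof.
move=> a0 [hX pX]; split; first by rewrite linearZ /= hX.
by move=> x; rewrite -scalemxAr -scalemxAl mxZE mulr_ge0.
Qed.

Lemma psd_gram k l (Y : 'M[R]_(l, k)) : psd (Y^T *m Y).
Proof.
have h : psd (1%:M : 'M[R]_l).
  split; first by rewrite trmx1.
  by move=> x; rewrite mulmx1 mxE sumr_ge0 // => i _; rewrite !mxE -expr2 sqr_ge0.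
by have := psd_congr Y h; rewrite mulmx1.
Qed.

Lemma lyapunov_real k (M P : 'M[R]_k) : hurwitz M -> P^T = P ->
  psd (- (M^T *m P + P *m M)) -> psd P.
Proof.
move=> /hurwitzP sM hP /psdP[_ h]; apply/psdP; split; first exact: hP.
apply: (lyapunov_psd sM); first by rewrite cmx_trC hP.
by move: h; rewrite cmxN cmxD !cmxM cmx_trC.
Qed.

Lemma sylvester_real p q (N : 'M[R]_p) (M : 'M[R]_q) (X : 'M[R]_(p, q)) :
  hurwitz N -> hurwitz M -> N^T *m X + X *m M = 0 -> X = 0.
Proof.
move=> /hurwitzP sN /hurwitzP sM h; apply: cmx_inj; rewrite cmx0.
by apply: (sylvester sN sM); rewrite cmx_trC -!cmxM -cmxD h cmx0.
Qed.

(* The Lyapunov operator is injective, hence onto, by finite dimension. *)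
Lemma lyapunov_solve k (M Q : 'M[R]_k) : hurwitz M -> Q^T = Q ->
  exists2 X, X^T = X & M^T *m X + X *m M = - Q.
Proof.
move=> hM hQ.
pose f (X : 'M[R]_k) := M^T *m X + X *m M.
pose F := lin_mx (mulmx M^T) + lin_mx (mulmxr M).
have FE X : mxvec X *m F = mxvec (f X).
  by rewrite mulmxDr !mul_vec_lin -linearD.
have Fu : F \in unitmx.
  rewrite -row_free_unit -kermx_eq0; apply/rowV0P => v /sub_kermxP.
  rewrite -[v]vec_mxK FE => /eqP; rewrite mxvec_eq0 => /eqP h.
  by rewrite (sylvester_real hM hM h) linear0.
have fs Z : exists X, f X = Z.
  exists (vec_mx (mxvec Z *m invmx F)); apply: (can_inj mxvecK).
  by rewrite -FE vec_mxK mulmxKV.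
have [X hX] := fs (- Q); exists X => //.
apply/eqP; rewrite -subr_eq0; apply/eqP; apply: (sylvester_real hM hM).
have : (f X)^T - f X = 0 by rewrite hX linearN /= hQ subrr.
by rewrite /f linearD /= !trmx_mul trmxK => <-; mx_norm; ring.
Qed.

Lemma posdef1 k : posdef (1%:M : 'M[R]_k).
Proof.
split; first by rewrite trmx1.
move=> x x0; rewrite mulmx1 mxE lt_def; apply/andP; split; last first.
  by rewrite sumr_ge0 // => i _; rewrite !mxE -expr2 sqr_ge0.
apply: contra x0; rewrite psumr_eq0 => [/allP h|i _]; last by rewrite !mxE -expr2 sqr_ge0.
apply/eqP/matrixP => i j; rewrite ord1 mxE.
have /h : i \in index_enum 'I_k by rewrite mem_index_enum.
by rewrite /= !mxE -expr2 sqrf_eq0 => /eqP.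
Qed.

Lemma dotr_eq0 k (x : 'cV[R]_k) : (x^T *m x) 0 0 = 0 -> x = 0.
Proof.
move=> h; apply/eqP; apply: contraT => x0.
by have [_ /(_ x x0)] := posdef1 k; rewrite mulmx1 h ltxx.
Qed.

(** Along [x + t *: y] with [y = X *m x] the form has no constant term, and its linear coefficient
    is twice the squared norm of [y]; nonnegativity for all [t] forces [y = 0]. *)
Lemma psd_ker k (X : 'M[R]_k) (x : 'cV[R]_k) :
  psd X -> (x^T *m X *m x) 0 0 = 0 -> X *m x = 0.
Proof.
move=> [hX pX] h; apply: dotr_eq0; have [y Ey] : exists y, X *m x = y by exists (X *m x).
rewrite Ey; set c := (_ 0 0); pose e := (y^T *m X *m y) 0 0.
have e0 : 0 <= e := pX y.
have q t : 0 <= 2 * t * c + t ^+ 2 * e.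
  have := pX (x + t *: y).
  have -> : (x + t *: y)^T *m X *m (x + t *: y)
    = x^T *m X *m x + (2 * t) *: (y^T *m y) + t ^+ 2 *: (y^T *m X *m y).
    have E1 : x^T *m X = y^T by rewrite -Ey trmx_mul hX.
    have E2 : y^T *m X *m x = y^T *m y by rewrite -mulmxA Ey.
    rewrite trmx_add trmx_scale; mx_expand; rewrite E1 E2.
    by mx_norm; ring.
  by rewrite !mxDE !mxZE h add0r.
have c0 : 0 <= c by rewrite /c mxE sumr_ge0 // => i _; rewrite !mxE -expr2 sqr_ge0.
(* The 1 in the denominator covers [e = 0]. *)
have := q (- c / (e + 1)).
have e1 : e + 1 != 0 by rewrite gt_eqF // ltr_wpDl.
have -> : 2 * (- c / (e + 1)) * c + (- c / (e + 1)) ^+ 2 * e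
   = - (c ^+ 2 * ((e + 2) / (e + 1) ^+ 2)) by field.
rewrite oppr_ge0 pmulr_lle0; last by rewrite divr_gt0 ?exprn_gt0 // ltr_wpDl.
by move=> le0; apply/eqP; rewrite -sqrf_eq0 eq_le le0 sqr_ge0.
Qed.

(** A null vector of the semidefinite [X] lies in its kernel, so the equation would make the form of
    [Q] vanish there. *)
Lemma lyapunov_posdef k (M Q X : 'M[R]_k) : hurwitz M -> posdef Q -> X^T = X ->
  M^T *m X + X *m M = - Q -> posdef X.
Proof.
move=> hM [hQ pQ] hX e.
have pX : psd X.
  by apply: (lyapunov_real hM hX); rewrite e opprK; exact: posdef_psd.
split; first exact: hX.
move=> x x0; rewrite lt_def pX.2 andbT; apply/eqP => h.
have Xx := psd_ker pX h.
have xX : x^T *m X = 0 by rewrite -hX -trmx_mul Xx trmx0.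
have := pQ x x0; rewrite -[Q]opprK -e mulmxN mulNmx mulmxDr mulmxDl !mulmxA xX.
by rewrite -[_ *m X *m x]mulmxA Xx mulmx0 !mul0mx addr0 oppr0 mxE ltxx.
Qed.

Definition ric m (A N Q P : 'M[R]_m) := A^T *m P + P *m A + Q - P *m N *m P.

Lemma cmx_ric m (A N Q P : 'M[R]_m) :
  cmx (ric A N Q P) = riccati (cmx A) (cmx N) (cmx Q) (cmx P).
Proof. by rewrite /ric /riccati cmx_trC !(cmxD, cmxN, cmxM). Qed.

Lemma ric_unique m (A N Q P1 P2 : 'M[R]_m) :
  N^T = N -> P1^T = P1 -> ric A N Q P1 = 0 -> ric A N Q P2 = 0 ->
  hurwitz (A - N *m P1) -> hurwitz (A - N *m P2) -> P1 = P2.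
Proof.
move=> hN h1 r1 r2 /hurwitzP s1 /hurwitzP s2; apply: cmx_inj.
apply: (@riccati_unique _ _ (cmx A) (cmx N) (cmx Q)).
- by rewrite cmx_trC hN.
- by rewrite cmx_trC h1.
- by rewrite -cmx_ric r1 cmx0.
- by rewrite -cmx_ric r2 cmx0.
- by move: s1; rewrite cmxD cmxN cmxM.
- by move: s2; rewrite cmxD cmxN cmxM.
Qed.

Lemma conj_cmx p q (X : 'M[R]_(p, q)) : map_mx Num.conj (cmx X) = cmx X.
Proof. by apply/matrixP => i j; rewrite !mxE conj_real. Qed.

(* By uniqueness the stabilizing solution equals its own conjugate. *)
Lemma riccati_real m (A N Q : 'M[R]_m) (P : 'M[R[i]]_m) :
  N^T = N -> P^t* = P -> riccati (cmx A) (cmx N) (cmx Q) P = 0 ->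
  stable (cmx A - cmx N *m P) -> exists P', P = cmx P'.
Proof.
move=> hN hP r s; exists (map_mx (@complex.Re R) P).
have eP : map_mx Num.conj P = P.
  apply: esym; apply: (riccati_unique _ hP r _ s); first by rewrite cmx_trC hN.
    move: (congr1 (map_mx Num.conj) r).
    by rewrite map_mx0 /riccati map_mxB !map_mxD !map_mxM !cmx_trC !conj_cmx.
  move=> z v v0 hv; rewrite -Re_conj; apply: (s _ (map_mx Num.conj v)).
    by rewrite map_mx_eq0.
  move: (congr1 (map_mx Num.conj) hv); rewrite map_mxM map_mxB map_mxM !conj_cmx map_mxZ.
  by rewrite -[map_mx _ (map_mx _ P)]map_mx_comp (map_mx_id (@conjCK _)).
apply/matrixP => i j; rewrite !mxE RRe_real //; apply/CrealP.
by move/matrixP: eP => /(_ i j); rewrite mxE.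
Qed.

Lemma riccati_real_solution m (A N Q : 'M[R]_m) (P : 'M[R[i]]_m) :
  N^T = N -> P^t* = P -> hpsd P -> riccati (cmx A) (cmx N) (cmx Q) P = 0 ->
  stable (cmx A - cmx N *m P) ->
  exists P', [/\ P = cmx P', psd P', ric A N Q P' = 0 & hurwitz (A - N *m P')].
Proof.
move=> hN hP pP r s; have [P' eP] := riccati_real hN hP r s.
rewrite {}eP in hP pP r s *; exists P'; split.
- by [].
- by apply/psdP; split; first by apply: cmx_inj; rewrite -cmx_trC.
- by apply: cmx_inj; rewrite cmx_ric cmx0.
- by apply/hurwitzP; rewrite cmxD cmxN cmxM.
Qed.

Lemma ric_comparison m (A N Q P0 : 'M[R]_m) : N^T = N -> psd Q ->
  (forall z (v : 'cV[R[i]]_m), v != 0 -> cmx A *m v = z *: v -> cmx Q *m v = 0 ->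
     'Re z < 0) ->
  posdef P0 -> posdef (- ric A N Q P0) ->
  exists P, [/\ psd P, psd (P0 - P), ric A N Q P = 0 & hurwitz (A - N *m P)].
Proof.
move=> hN /psdP[hQ pQ] det /posdefP[h0 p0] /posdefP[_].
rewrite cmxN cmx_ric => pF.
have [|||P [hP pP pd r s]] := riccati_comparison _ _ pQ det _ p0 pF.
- by rewrite cmx_trC hN.
- by rewrite cmx_trC hQ.
- by rewrite cmx_trC h0.
have [P' [eP pP' r' s']] := riccati_real_solution hN hP pP r s.
exists P'; split=> [//| |//|//].
apply/psdP; split; first by rewrite linearB /= h0 pP'.1.
by rewrite cmxD cmxN -eP.
Qed.

Lemma ric_bounded_real m n (A Q : 'M[R]_m) (D : 'M[R]_(m, n)) : psd Q -> hurwitz A ->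
  (forall z (x y : 'cV[R[i]]_m), 'Re z = 0 ->
     cmx A *m x + cmx D *m (cmx D)^t* *m y = z *: x ->
     - (cmx Q *m x) - (cmx A)^t* *m y = z *: y -> x = 0 /\ y = 0) ->
  exists P, [/\ psd P, ric A (- (D *m D^T)) Q P = 0 & hurwitz (A + D *m D^T *m P)].
Proof.
move=> /psdP[hQ pQ] /hurwitzP sA im.
have hN : (- (D *m D^T))^T = - (D *m D^T) by rewrite linearN /= trmx_mul trmxK.
have [|P [hP pP r s]] := bounded_real _ pQ sA im; first by rewrite cmx_trC hQ.
have eN : - (cmx D *m (cmx D)^t*) = cmx (- (D *m D^T)).
  by rewrite cmxN cmxM cmx_trC.
rewrite eN in r s.
have [P' [_ pP' r' s']] := riccati_real_solution hN hP pP r s.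
exists P'; split=> [//|//|].
by move: s'; rewrite mulNmx opprK.
Qed.

End RealMatrices.

(** * Square roots of real semidefinite matrices *)

Section SquareRoot.

(** Each new point is matched by adding a multiple of the product that vanishes at the earlier
    ones. *)
Lemma poly_interpolation (F : fieldType) (f : F -> F) (s : seq F) :
  exists p : {poly F}, {in s, forall x, p.[x] = f x}.
Proof.
elim: s => [|a s [p hp]]; first by exists 0.
have [as_|nas] := boolP (a \in s).
  by exists p => x; rewrite inE => /orP[/eqP->|]; exact: hp.
pose q := \prod_(y <- s) ('X - y%:P).
have qa : q.[a] != 0 by rewrite -/(root q a) root_prod_XsubC.
have qs x : x \in s -> q.[x] = 0 by move=> xs; apply/eqP; rewrite -/(root q x) root_prod_XsubC.
exists (p + ((f a - p.[a]) / q.[a]) *: q) => x.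
rewrite inE hornerD hornerZ => /orP[/eqP->|xs].
  by rewrite divfK // addrC subrK.
by rewrite (qs _ xs) mulr0 addr0 hp.
Qed.

Variable R : realType.

(* The square root is a real polynomial in [Q], so no real spectral theorem is
   needed. *)
Lemma psd_sqrt_exists k (Q : 'M[R]_k) : psd Q -> exists S, psd S /\ S *m S = Q.
Proof.
case: k Q => [|k] Q pQ.
  exists 0; split; last by apply/matrixP => -[].
  by split=> [|x]; [rewrite trmx0 | rewrite mulmx0 mul0mx mxE].
have [hQ hpQ] := (psdP Q).1 pQ.
have [|P [d [PP d0 hor]]] := hpsd_spectral _ hpQ; first by rewrite cmx_trC hQ.
pose r i := complex.Re (d 0 i).
have dr i : d 0 i = (r i)%:C by rewrite /r RRe_real // ger0_real.
have r0 i : 0 <= r i by rewrite -ler0c -dr.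
have [p hp] := poly_interpolation (@Num.sqrt R) [seq r i | i : 'I_k.+1].
pose e : 'rV_k.+1 := \row_i (Num.sqrt (r i))%:C.
have e0 i : 0 <= e 0 i by rewrite mxE ler0c sqrtr_ge0.
have [] := gram_diag PP (fun i => ger0_real (e0 i)).
have eS : cmx (horner_mx Q p) = P^t* *m diag_mx e *m P.
  rewrite cmxE map_horner_mx -cmxE hor.
  suff -> : map_mx (horner (map_poly (real_complex R) p)) d = e by [].
  apply/matrixP => i j; rewrite !mxE ord1 dr horner_map hp //.
  by apply: map_f; rewrite mem_enum.
rewrite -eS cmx_trC -cmxM => /cmx_inj hS eSS.
exists (horner_mx Q p); split.
  by apply/psdP; split; [exact: hS | rewrite eS; exact: hpsd_diag].
apply: cmx_inj; rewrite eSS -[cmx Q]horner_mx_X hor.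
suff -> : map_mx (fun x => x ^+ 2) e = map_mx (horner 'X) d by [].
apply/matrixP => i j; rewrite !mxE hornerX ord1 dr.
by rewrite -rmorphXn /= sqr_sqrtr.
Qed.

Lemma psd_sqrtP k (Q : 'M[R]_k) : psd Q -> psd (psd_sqrt Q) /\ psd_sqrt Q *m psd_sqrt Q = Q.
Proof.
move=> /psd_sqrt_exists[S hS].
exact: (@xgetI _ 0 [set S : 'M[R]_k | psd S /\ S *m S = Q]%classic S hS).
Qed.

End SquareRoot.

(** * Small perturbations, limits, and the converse Lyapunov theorem *)

Section Perturbation.
Variable R : realType.

Lemma form_real_le k (X : 'M[R]_k) (x : 'cV[R]_k) :
  (x^T *m X *m x) 0 0 <= (\sum_i \sum_j `|X i j|) * (x^T *m x) 0 0.
Proof.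
have xi i : `|x i 0| ^+ 2 <= (x^T *m x) 0 0.
  rewrite mxE (bigD1 i) //= !mxE -expr2 real_normK ?num_real // lerDl.
  by apply: sumr_ge0 => j _; rewrite !mxE -expr2 sqr_ge0.
move: ((x^T *m x) 0 0) xi => N xi.
rewrite -mulmxA (le_trans (ler_norm _)) // mxE (le_trans (ler_norm_sum _ _ _)) //.
rewrite mulr_suml ler_sum // => i _.
rewrite !mxE normrM mulr_suml.
rewrite (le_trans (ler_wpM2l (normr_ge0 _) (ler_norm_sum _ _ _))) // mulr_sumr.
rewrite ler_sum // => j _; rewrite normrM mulrCA ler_wpM2l //.
have [hij|/ltW hij] := leP `|x i 0| `|x j 0|.
  by rewrite (le_trans _ (xi j)) // expr2 ler_wpM2r.
by rewrite (le_trans _ (xi i)) // expr2 ler_wpM2l.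
Qed.

Lemma small_posdef k (X : 'M[R]_k) : X^T = X ->
  exists2 t0, 0 < t0 & forall t, 0 <= t -> t < t0 -> posdef (1%:M - t *: X).
Proof.
move=> hX; pose c := \sum_i \sum_j `|X i j|.
have c0 : 0 <= c by apply: sumr_ge0 => i _; apply: sumr_ge0.
exists (c + 1)^-1; first by rewrite invr_gt0 ltr_wpDl.
move=> t t0 ht; split; first by rewrite trmx_add trmx_opp trmx_scale hX trmx1.
move=> x x0; rewrite mulmxBr mulmxBl mulmx1 -scalemxAr -scalemxAl mxDE mxNE mxZE subr_gt0.
have xx : 0 < (x^T *m x) 0 0.
  by have := (posdef1 R k).2 x x0; rewrite mulmx1.
rewrite (le_lt_trans (ler_wpM2l t0 (form_real_le X x))) // mulrA gtr_pMl //.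
rewrite (le_lt_trans (_ : _ <= t * (c + 1))) ?ler_wpM2l ?lerDl //.
by rewrite -ltr_pdivlMr ?div1r // ltr_wpDl.
Qed.

Lemma posdefZ k a (X : 'M[R]_k) : 0 < a -> posdef X -> posdef (a *: X).
Proof.
move=> a0 [hX pX]; split; first by rewrite trmx_scale hX.
by move=> x x0; rewrite -scalemxAr -scalemxAl mxZE mulr_gt0 // pX.
Qed.

Lemma psd_limit k (X Y : 'M[R]_k) e0 : Y^T = Y -> 0 < e0 ->
  (forall e, 0 < e -> e < e0 -> psd (Y + e *: X)) -> psd Y.
Proof.
move=> hY e00 h; split=> // x; rewrite leNgt; apply/negP => Yx.
set a := (x^T *m Y *m x) 0 0 in Yx; pose b := (x^T *m X *m x) 0 0.
have q e : 0 < e -> e < e0 -> 0 <= a + e * b.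
  move=> ep el; have := (h e ep el).2 x.
  by rewrite mulmxDr mulmxDl -scalemxAr -scalemxAl mxDE mxZE.
(* So small that [e * b] is at most half of [- a], which leaves the form negative at [x]. *)
pose e := Num.min (e0 / 2) (- a / (2 * (`|b| + 1))).
have b1 : 0 < 2 * (`|b| + 1) by rewrite mulr_gt0 // ltr_wpDl.
have ep : 0 < e by rewrite lt_min !divr_gt0 // oppr_gt0.
have el : e < e0 by rewrite gt_min ltr_pdivrMr // ltr_pMr // ltr1n.
have eb : e * (2 * (`|b| + 1)) <= - a by rewrite -ler_pdivlMr // ge_min lexx orbT.
have bb : e * b <= e * `|b| by rewrite ler_pM2l // ler_norm.
have := q e ep el; have := normr_ge0 b.
move: eb bb Yx ep; set c := `|b|; nra.
Qed.

(** At an eigenvector for [z] the assumed positive form is minus twice the real part of [z] times a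
    positive number. *)
Lemma lyapunov_hurwitz k (M P : 'M[R]_k) :
  posdef P -> posdef (- (M^T *m P + P *m M)) -> hurwitz M.
Proof.
move=> /posdefP[hP pP] /posdefP[_ pM]; apply/hurwitzP => z v v0 hv.
have := pM v v0; have := pP v v0.
rewrite cmxN cmxD !cmxM -cmx_trC.
have -> : v^t* *m - ((cmx M)^t* *m cmx P + cmx P *m cmx M) *m v
   = - (z^* + z)%R *: (v^t* *m cmx P *m v).
  have e : v^t* *m (cmx M)^t* = (z^*)%R *: v^t* by rewrite -trmxCM hv trmxCZ.
  mx_expand; rewrite e -[_ *m cmx M *m v]mulmxA hv.
  by mx_norm; ring.
move=> p0; rewrite mxZE pmulr_lgt0 // oppr_gt0 => h.
by rewrite ReE pmulr_llt0 ?invr_gt0 // addrC.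
Qed.

End Perturbation.

(** * The bounded real lemma *)

Section StrictRiccati.
Variables (R : realType) (m n : nat) (M G Q : 'M[R]_m) (D : 'M[R]_(m, n)).
Hypotheses (hG : G = D *m D^T) (pQ : psd Q).

(** The residual of the bounded real Riccati equation. The [D] of this section will be
    [gamma^-1 *: D], so that [G] carries the factor [gamma ^- 2]. *)
Definition brl_ric P := M^T *m P + P *m M + Q + P *m G *m P.

Definition brl_stab P := [/\ psd P, brl_ric P = 0 & hurwitz (M + G *m P)].

Lemma gram_sym : G^T = G.
Proof. by rewrite hG trmx_mul trmxK. Qed.

Lemma psd_gram_congr P : P^T = P -> psd (P *m G *m P).
Proof. by move=> hP; have := psd_gram (D^T *m P); rewrite trmx_mul trmxK hP hG !mulmxA. Qed.

Lemma brl_ricE P : ric M (- G) Q P = brl_ric P.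
Proof. by rewrite /ric /brl_ric mulmxN mulNmx opprK. Qed.

Lemma brl_stab_unique P1 P2 : brl_stab P1 -> brl_stab P2 -> P1 = P2.
Proof.
have hN : (- G)^T = - G by rewrite trmx_opp gram_sym.
have e P : M + G *m P = M - - G *m P by rewrite mulNmx opprK.
move=> [[h1 _]]; rewrite -brl_ricE e => r1 s1 [_]; rewrite -brl_ricE e => r2 s2.
exact: (ric_unique hN h1 r1 r2 s1 s2).
Qed.

Lemma brl_ric_lyap P : P^T = P -> posdef (- brl_ric P) ->
  posdef (- (M^T *m P + P *m M)).
Proof.
move=> hP pF.
have -> : - (M^T *m P + P *m M) = (Q + P *m G *m P) + (- brl_ric P).
  by rewrite /brl_ric; mx_norm; ring.
by apply: posdefD pF; apply: psdD (psd_gram_congr hP).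
Qed.

(** A Hurwitz [M] supplies what [ric_comparison] asks for: [P] is positive definite by Lyapunov, and
    all modes of [M] are stable. *)
Lemma brl_strict P : hurwitz M -> P^T = P -> posdef (- brl_ric P) ->
  exists2 P', brl_stab P' & psd (P - P').
Proof.
move=> hM hP pF; have pL := brl_ric_lyap hP pF.
have pP : posdef P by apply: (lyapunov_posdef hM pL hP); rewrite opprK.
have hN : (- G)^T = - G by rewrite trmx_opp gram_sym.
rewrite -brl_ricE in pF.
have [|P' [p1 p2 r s]] := ric_comparison hN pQ _ pP pF.
  by move=> z v v0 hv _; move/hurwitzP: hM => /(_ z v v0 hv).
exists P'; last exact: p2.
split; [exact: p1 | by rewrite -brl_ricE | by move: s; rewrite mulNmx opprK].
Qed.

(** [X] solves the Lyapunov equation of [M + G *m P] with right side [- 1%:M]. The residual thus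
    moves by [- e] times the identity to first order, which dominates the quadratic term; strictness
    in turn makes [M] Hurwitz. *)
Lemma brl_stab_perturb P : brl_stab P ->
  exists X, [/\ posdef X, hurwitz M
    & exists2 e0, 0 < e0 & forall e, 0 < e -> e < e0 ->
      psd (- (2^-1 * e) *: 1%:M - brl_ric (P + e *: X)) /\
      posdef (- brl_ric (P + e *: X))].
Proof.
move=> [pP r s].
have hS := gram_sym.
have [X hX eX] := lyapunov_solve s (posdef1 R m).1.
have pX := lyapunov_posdef s (posdef1 R m) hX eX.
have eF e : - brl_ric (P + e *: X) = e *: (1%:M - e *: (X *m G *m X)).
  have -> : brl_ric (P + e *: X) = brl_ric P
     + e *: ((M + G *m P)^T *m X + X *m (M + G *m P)) + e ^+ 2 *: (X *m G *m X).
    rewrite /brl_ric trmx_add trmx_mul hS pP.1 expr2; mx_expand.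
    by mx_norm; ring.
  by rewrite r eX; mx_norm; ring.
have hXX : (X *m G *m X)^T = X *m G *m X by exact: (psd_gram_congr hX).1.
have [t0 t0p ht] := small_posdef hXX.
have pd e : 0 < e -> e < t0 -> posdef (- brl_ric (P + e *: X)).
  by move=> ep el; rewrite eF; apply: posdefZ => //; apply: ht => //; exact: ltW.
have e2 : 0 < t0 / 2 by rewrite divr_gt0.
exists X; split; first exact: pX.
  have el : t0 / 2 < t0 by rewrite ltr_pdivrMr // ltr_pMr // ltr1n.
  have hPX : (P + (t0 / 2) *: X)^T = P + (t0 / 2) *: X.
    by rewrite trmx_add trmx_scale hX pP.1.
  apply: (lyapunov_hurwitz _ (brl_ric_lyap hPX (pd _ e2 el))).
  by apply: (posdefD pP); exact: posdefZ.
(* With [2 * e] below [t0], half of the margin [e] survives as a multiple of the identity. *)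
exists (t0 / 2) => // e ep el.
have el2 : 2 * e < t0 by move: el; rewrite ltr_pdivlMr // mulrC.
split; last by apply: (pd _ ep); rewrite (le_lt_trans _ el2) // mulr_natl mulr2n lerDl ltW.
rewrite eF; have -> : - (2^-1 * e) *: 1%:M + e *: (1%:M - e *: (X *m G *m X))
   = (2^-1 * e) *: (1%:M - (2 * e) *: (X *m G *m X)) :> 'M[R]_m.
  by mx_norm; field.
apply/posdef_psd/posdefZ; first by rewrite mulr_gt0 // invr_gt0.
by apply: ht => //; rewrite mulr_ge0 // ltW.
Qed.

End StrictRiccati.

(** * The norm bound and the stabilizing solution *)

Section BoundedReal.
Variable R : realType.

Lemma sigma_max_ge p q (X : 'M[R[i]]_(p, q)) (s : R) :
  0 <= s -> eigenvalue (X^t* *m X) (s ^+ 2)%:C -> s <= sigma_max X.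
Proof.
move=> s0 es; apply: ub_le_sup; last by split.
pose c := \sum_i \sum_j `|(X^t* *m X) i j|.
have c0 : 0 <= c by apply: sumr_ge0 => i _; apply: sumr_ge0.
(* [t ^+ 2] is at most [c]; adding 1 bounds [t] itself. *)
exists (1 + complex.Re c) => t [t0 /eigenvalue_colP[w hw w0]].
have /RRe_real cr : c \is Num.real by rewrite ger0_real.
have := form_norm_le (X^t* *m X) w.
rewrite -mulmxA hw -scalemxAr mxZE normrM [`|(_ *m w) 0 0|]ger0_norm ?dot_ge0 //.
rewrite ler_pM2r ?dot_gt0 // -/c -cr ger0_norm ?ler0c ?sqr_ge0 // lecR => h.
have : 0 <= (t - 2^-1) ^+ 2 by exact: sqr_ge0.
have : 0 <= complex.Re c by rewrite -ler0c cr.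
by move: h t0; nra.
Qed.

Lemma sigma_max_le p q (X : 'M[R[i]]_(p, q)) (b : R) : 0 <= b ->
  (forall w : 'cV_q, (w^t* *m (X^t* *m X) *m w) 0 0 <= (b ^+ 2)%:C * (w^t* *m w) 0 0) ->
  sigma_max X <= b.
Proof.
move=> b0 h; rewrite /sigma_max; set S := [set s | _]%classic.
(* The supremum of the empty set is 0, which [0 <= b] covers. *)
have [-> |/set0P S0] := eqVneq S set0%classic; first by rewrite sup0.
apply: ge_sup => // t [t0 /eigenvalue_colP[w hw w0]].
have := h w; rewrite -mulmxA hw -scalemxAr mxZE ler_pM2r ?dot_gt0 // lecR.
by rewrite ler_sqr.
Qed.

Variables (m n : nat) (M Q : 'M[R]_m) (D : 'M[R]_(m, n)) (gamma : R).
Hypotheses (pQ : psd Q) (g0 : 0 < gamma).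

Let T (s : R[i]) : 'M[R[i]]_(m, n) := cmx (psd_sqrt Q) *m invmx (s%:M - cmx M) *m cmx D.
Let G := gamma ^- 2 *: (D *m D^T).

Lemma transfer_gram s : (T s)^t* *m T s = response (cmx M) (cmx Q) (cmx D) s.
Proof.
have [[hS _] SS] := psd_sqrtP pQ.
have eS : (cmx (psd_sqrt Q))^t* = cmx (psd_sqrt Q) by rewrite cmx_trC hS.
have eQ : cmx Q = cmx (psd_sqrt Q) *m cmx (psd_sqrt Q) by rewrite -cmxM SS.
by rewrite /T /response eQ !trmxCM eS !mulmxA.
Qed.

Lemma scaled_gramE : G = (gamma^-1 *: D) *m (gamma^-1 *: D)^T.
Proof. by rewrite /G trmx_scale -scalemxAl -scalemxAr scalerA -expr2 exprVn. Qed.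

Lemma Re_imag_axis w : 'Re (Complex 0 w : R[i]) = 0.
Proof. by rewrite -complexRe. Qed.

(** An imaginary Hamiltonian eigenvalue would make [gamma ^+ 2] an eigenvalue of the Gram matrix of
    [T] at that frequency, so the norm would reach [gamma]. *)
Lemma hinf_stab : hurwitz M -> (hinf_norm T < gamma%:E)%E ->
  exists P, brl_stab M G Q P.
Proof.
move=> hM hT; have /hurwitzP sM := hM.
have [|P [pP r s]] := @ric_bounded_real _ _ _ M Q (gamma^-1 *: D) pQ hM.
  move=> z x y z0; apply: (response_no_imag sM z0) => w hw.
  apply/eqP; apply: contraT => w0.
  have [t zt] : exists t, z = Complex 0 t.
    exists (complex.Im z); case: z z0 {hw} => a b.
    by rewrite -complexRe /= => -[->].
  have /(sigma_max_ge (ltW g0)) : eigenvalue ((T z)^t* *m T z) (gamma ^+ 2)%:C.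
    apply/eigenvalue_colP; exists w => //; rewrite transfer_gram.
    rewrite -{2}hw scalemxAl; congr (_ *m _).
    rewrite /response cmxZ -!scalemxAr trmxCZ conj_real -!scalemxAl !scalerA.
    by rewrite -!rmorphM /= -expr2 exprVn divff ?scale1r // expf_neq0 // gt_eqF.
  rewrite zt leNgt => /negP[]; rewrite -lte_fin; apply: le_lt_trans hT.
  by apply: ereal_sup_ubound; exists t.
exists P; rewrite -scaled_gramE in r s; split=> //.
by rewrite -brl_ricE.
Qed.

(** The margin of [brl_stab_perturb] pays for replacing [gamma ^- 2] by a larger [k]. The resulting
    bound, below [gamma], is the same at all frequencies, so the supremum stays strictly below
    [gamma]. *)
Lemma stab_hinf P : brl_stab M G Q P -> hurwitz M /\ (hinf_norm T < gamma%:E)%E.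
Proof.
move=> st; have [X [pX hM [e0 e00 he]]] := brl_stab_perturb scaled_gramE pQ st.
split=> //; have /hurwitzP sM := hM.
have e2 : 0 < e0 / 2 by rewrite divr_gt0.
have el : e0 / 2 < e0 by rewrite ltr_pdivrMr // ltr_pMr // ltr1n.
have [p1 _] := he _ e2 el; move: p1; set e := 2^-1 * _; set P1 := P + _.
have hP1 : P1^T = P1 by rewrite /P1 trmx_add trmx_scale pX.1; case: st => -[->].
have ep : 0 < e by rewrite mulr_gt0 // invr_gt0.
clearbody e P1 => p1.
have [t0 t0p ht] := small_posdef (psd_gram (D^T *m P1)).1.
pose t := t0 / 2; have tp : 0 < t by rewrite divr_gt0.
have tl : t < t0 by rewrite /t ltr_pdivrMr // ltr_pMr // ltr1n.
pose k := gamma ^- 2 + e * t.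
have kp : 0 < k by rewrite addr_gt0 ?mulr_gt0 // invr_gt0 exprn_gt0.
have p2 : psd (- (M^T *m P1 + P1 *m M + Q + k *: (P1 *m D *m (D^T *m P1)))).
  have -> : - (M^T *m P1 + P1 *m M + Q + k *: (P1 *m D *m (D^T *m P1)))
      = (- e *: 1%:M - brl_ric M G Q P1)
        + e *: (1%:M - t *: ((D^T *m P1)^T *m (D^T *m P1))).
    rewrite /brl_ric /G trmx_mul trmxK hP1 /k.
    by mx_norm; ring.
  apply: psdD => //; apply: psdZ; first exact: ltW.
  by apply/posdef_psd/ht => //; exact: ltW.
have b0 : 0 <= Num.sqrt k^-1 by exact: sqrtr_ge0.
apply: (@le_lt_trans _ _ (Num.sqrt k^-1)%:E); last first.
  rewrite lte_fin -[ltRHS](ger0_norm (ltW g0)) -sqrtr_sqr ltr_sqrt ?exprn_gt0 //.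
  rewrite invf_plt ?posrE ?exprn_gt0 //.
  by rewrite /k ltrDl mulr_gt0.
apply: ge_ereal_sup => _ [w _ <-]; rewrite lee_fin; apply: sigma_max_le => // v.
rewrite transfer_gram sqr_sqrtr ?invr_ge0 ?(ltW kp) //.
have := @response_le _ _ _ (cmx M) (cmx Q) (cmx P1) (cmx D) (Complex 0 w) k%:C v sM.
rewrite fmorphV; apply.
- exact: Re_imag_axis.
- by rewrite cmx_trC hP1.
- by rewrite (ltcR 0).
have /psdP[_] := p2.
by rewrite cmxN !cmxD cmxZ !cmxM !cmx_trC.
Qed.

End BoundedReal.

(** * The design problem *)

Section Krylov.
Variable R : realType.

Lemma mulmx_col0 p q r (X : 'M[R]_(p, q)) (Z : 'M[R]_(q, r)) :
  (forall j, X *m col j Z = 0) -> X *m Z = 0.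
Proof.
move=> h; apply/matrixP => i j; have /matrixP/(_ i 0) := h j.
by rewrite colE mulmxA -colE mxE [RHS]mxE => ->; rewrite mxE.
Qed.

Lemma form_col p q (X : 'M[R]_p) (Z : 'M[R]_(p, q)) j :
  ((col j Z)^T *m X *m col j Z) 0 0 = (Z^T *m X *m Z) j j.
Proof.
rewrite !mxE; apply: eq_bigr => i _; rewrite !mxE; congr (_ * _).
by apply: eq_bigr => k _; rewrite !mxE.
Qed.

(** The trace is the sum of the form of [X] over the columns of [D]. *)
Lemma psd_congr_trace p q (X : 'M[R]_p) (D : 'M[R]_(p, q)) :
  psd X -> 0 <= \tr (X *m D *m D^T).
Proof.
move=> [_ pX]; rewrite mxtrace_mulC mulmxA; apply: sumr_ge0 => j _.
by rewrite -form_col.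
Qed.

Lemma psd_congr_trace_eq0 p q (X : 'M[R]_p) (D : 'M[R]_(p, q)) :
  psd X -> \tr (X *m D *m D^T) = 0 -> X *m D = 0.
Proof.
move=> pX /eqP; rewrite mxtrace_mulC mulmxA psumr_eq0 => [/allP h|j _]; last first.
  by rewrite -form_col; exact: pX.2.
apply: mulmx_col0 => j; apply: (psd_ker pX); rewrite form_col.
by have /h/eqP : j \in index_enum 'I_q by rewrite mem_index_enum.
Qed.

Lemma posdef_congr_eq0 p q (X : 'M[R]_p) (Z : 'M[R]_(p, q)) :
  posdef X -> Z^T *m X *m Z = 0 -> Z = 0.
Proof.
move=> [_ pX] h; rewrite -[Z]mul1mx; apply: mulmx_col0 => j; rewrite mul1mx.
apply/eqP; apply: contraT => /pX; rewrite form_col h mxE ltxx.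
by [].
Qed.

Lemma krylov_inj p q r (M : 'M[R]_p) (D : 'M[R]_(p, q)) (H : 'M[R]_(r, p)) :
  controllable M D -> (forall k, H *m (M ^+ k *m D) = 0) -> H = 0.
Proof.
rewrite /controllable; set Z := (\mxrow_k _) => rk h.
have fZ : row_free Z by rewrite /row_free rk.
apply: (row_free_inj fZ); rewrite mul0mx /Z mul_mxrow -[RHS]mxrow0.
by apply: eq_mxrow => k; exact: h.
Qed.

Lemma sylvester_krylov_real p q r (N : 'M[R]_p) (M : 'M[R]_q) (X : 'M[R]_(p, q))
    (D : 'M[R]_(q, r)) : hurwitz N -> hurwitz M ->
  (forall k, N^T *m X *m (M ^+ k *m D) + X *m (M ^+ k.+1 *m D) = 0) ->
  forall k, X *m (M ^+ k *m D) = 0.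
Proof.
have cX k : cmx (M ^+ k) = (cmx M) ^+ k.
  elim: k => [|k IH]; first by rewrite !expr0 cmx1.
  by rewrite !exprS -!mulmxE cmxM IH.
move=> /hurwitzP sN /hurwitzP sM h k; apply: cmx_inj; rewrite cmx0 cmxM.
apply: (sylvester_krylov sN sM) => j; rewrite cmx_trC -!cX -!cmxM -cmxD.
apply: (etrans (congr1 (@cmx R _ _) _) (cmx0 _ _ _)).
by rewrite ![_ *m (M ^+ k *m D)]mulmxA mulmxE -!exprD addSn h.
Qed.

End Krylov.

(** * Completing the square and the game Riccati equation *)

Section ClosedLoop.
Variables (R : realType) (m n d l : nat) (A : 'M[R]_m) (B : 'M[R]_(m, d))
  (C : 'M[R]_(l, m)) (D : 'M[R]_(m, n)) (Rw : 'M[R]_d) (G : 'M[R]_m)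
  (D1 : 'M[R]_(m, n)).
Hypotheses (hRw : posdef Rw) (hG : G = D1 *m D1^T).

Definition gain (P : 'M[R]_m) : 'M[R]_(d, m) := invmx Rw *m B^T *m P.

(** The residual of the game algebraic Riccati equation: the control enters through [B Rw^-1 B^T],
    the worst disturbance through [- G]. *)
Definition gare P := ric A (B *m invmx Rw *m B^T - G) (C^T *m C) P.

Definition loop_stab K P :=
  brl_stab (A - B *m K) G (C^T *m C + K^T *m Rw *m K) P.

Lemma Rw_unit : Rw \in unitmx.
Proof.
have /posdefP[_ /hpd_unitmx] := hRw.
by rewrite cmxE map_unitmx.
Qed.

Lemma weight_psd K : psd (C^T *m C + K^T *m Rw *m K).
Proof. by apply: psdD; [exact: psd_gram | apply/psd_congr/posdef_psd]. Qed.

Lemma invRw_sym : (invmx Rw)^T = invmx Rw.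
Proof. by rewrite trmx_inv hRw.1. Qed.

Lemma quad_sym : (B *m invmx Rw *m B^T - G)^T = B *m invmx Rw *m B^T - G.
Proof. by rewrite trmx_add trmx_opp (gram_sym hG) !trmx_mul trmxK invRw_sym mulmxA. Qed.

Lemma Rw_gain P : Rw *m gain P = B^T *m P.
Proof. by rewrite /gain !mulmxA mulmxV ?Rw_unit // mul1mx. Qed.

Lemma gain_Rw P : P^T = P -> (gain P)^T *m Rw = P *m B.
Proof. by move=> hP; rewrite -hRw.1 -trmx_mul Rw_gain trmx_mul trmxK hP. Qed.

Lemma B_gain P : B *m gain P = B *m invmx Rw *m B^T *m P.
Proof. by rewrite /gain !mulmxA. Qed.

(** The terms linear in [K] are absorbed by [Rw *m gain P = B^T *m P]. This separates the dependence
    on [K] from an operator common to all loops. *)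
Lemma complete_square K P : P^T = P ->
  brl_ric (A - B *m K) G (C^T *m C + K^T *m Rw *m K) P
  = gare P + (K - gain P)^T *m Rw *m (K - gain P).
Proof.
move=> hP; rewrite /brl_ric /gare /ric !trmx_add !trmx_opp trmx_mul.
have -> : P *m (B *m invmx Rw *m B^T - G) *m P = (gain P)^T *m Rw *m gain P - P *m G *m P.
  by rewrite gain_Rw // -mulmxA mulmxBl -B_gain mulmxBr !mulmxA.
have := Rw_gain P; have := gain_Rw hP; move: (gain P) => K1 e1 e2.
mx_expand; rewrite e1 -[_ *m Rw *m K1]mulmxA e2.
by mx_norm; ring.
Qed.

Lemma gain_loop P : A - B *m gain P + G *m P = A - (B *m invmx Rw *m B^T - G) *m P.
Proof. by rewrite B_gain; mx_norm; ring. Qed.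

(** For this gain the square vanishes and the two closed-loop matrices coincide. *)
Lemma gare_stab P : psd P -> gare P = 0 ->
  hurwitz (A - (B *m invmx Rw *m B^T - G) *m P) -> loop_stab (gain P) P.
Proof.
move=> pP r s; split; first exact: pP.
  by rewrite (complete_square _ pP.1) subrr mulmx0 addr0.
by rewrite gain_loop.
Qed.

Lemma stab_gare P : loop_stab (gain P) P ->
  gare P = 0 /\ hurwitz (A - (B *m invmx Rw *m B^T - G) *m P).
Proof.
move=> [pP]; rewrite (complete_square _ pP.1) subrr mulmx0 addr0 gain_loop.
by move=> r s; split.
Qed.

Lemma gare_unique P1 P2 : psd P1 -> gare P1 = 0 -> gare P2 = 0 ->
  hurwitz (A - (B *m invmx Rw *m B^T - G) *m P1) ->
  hurwitz (A - (B *m invmx Rw *m B^T - G) *m P2) -> P1 = P2.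
Proof. by move=> pP r1 r2 s1 s2; apply: (ric_unique quad_sym pP.1 r1 r2 s1 s2). Qed.

(** Since [C] kills [v], output injection does not move the mode: it is also one of the Hurwitz
    matrix [A - L *m C]. *)
Lemma detectable_mode z (v : 'cV[R[i]]_m) : detectable A C -> v != 0 ->
  cmx A *m v = z *: v -> cmx (C^T *m C) *m v = 0 -> 'Re z < 0.
Proof.
move=> [L /hurwitzP sL] v0 hv hC; apply: (sL z v v0).
have Cv : cmx C *m v = 0.
  apply/eqP; apply: contraT => /dot_gt0.
  by rewrite trmxCM cmx_trC -mulmxA [cmx C^T *m _]mulmxA -cmxM hC mulmx0 mxE ltxx.
by rewrite cmxD cmxN cmxM mulmxBl hv -mulmxA Cv mulmx0 subr0.
Qed.

(* [P + e X] makes the Riccati inequality of a feasible loop strict, so that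
   [ric_comparison] applies; by uniqueness its solution does not depend on the
   loop nor on [e]. *)
Lemma gare_minimal : detectable A C -> (exists K P, loop_stab K P) ->
  exists P, [/\ psd P, gare P = 0, hurwitz (A - (B *m invmx Rw *m B^T - G) *m P)
    & forall K P', loop_stab K P' -> psd (P' - P)].
Proof.
move=> det [K0 [P0 st0]].
have step K P : loop_stab K P -> exists X, psd X /\ exists2 e0, 0 < e0 &
    forall e, 0 < e -> e < e0 -> exists P', [/\ psd P', psd (P + e *: X - P'),
      gare P' = 0 & hurwitz (A - (B *m invmx Rw *m B^T - G) *m P')].
  move=> st; have [X [pX _ [e0 e00 he]]] := brl_stab_perturb hG (weight_psd K) st.
  exists X; split; first exact: posdef_psd.
  exists e0 => // e ep el; have [_ pF] := he e ep el.
  have pPX : posdef (P + e *: X) by apply: posdefD; [case: st | exact: posdefZ].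
  (* The game residual is the loop residual minus a square, so strictness passes to it. *)
  have pg : posdef (- gare (P + e *: X)).
    have -> : - gare (P + e *: X) = (K - gain (P + e *: X))^T *m Rw *m (K - gain (P + e *: X))
        + - brl_ric (A - B *m K) G (C^T *m C + K^T *m Rw *m K) (P + e *: X).
      rewrite (complete_square _ pPX.1); move: (gare _) (_ *m _ *m _) => g W.
      by rewrite opprD addrCA subrr addr0.
    by apply: posdefD => //; apply/psd_congr/posdef_psd.
  apply: (ric_comparison quad_sym (psd_gram C) _ pPX pg) => z v.
  exact: detectable_mode.
have [X [_ [e0 e00 h0]]] := step _ _ st0.
have e2 : 0 < e0 / 2 by rewrite divr_gt0.
have el : e0 / 2 < e0 by rewrite ltr_pdivrMr // ltr_pMr // ltr1n.
have [P [pP _ r s]] := h0 _ e2 el.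
exists P; split; [exact: pP | exact: r | exact: s |] => K P' st.
have [Y [pY [e1 e10 h1]]] := step _ _ st.
have hP' : P'^T = P' by case: st => -[].
(* Let [e] tend to 0 in [P' + e *: Y - P]. *)
apply: (@psd_limit _ _ Y _ e1) => // [|e ep ee].
  by rewrite trmx_add trmx_opp hP' pP.1.
have [P2 [pP2 hP2 r2 s2]] := h1 e ep ee.
by rewrite addrAC (gare_unique pP r r2 s s2).
Qed.

End ClosedLoop.

(** * Descent directions and what their absence implies *)

Section Descent.
Variables (R : realType) (m n d l : nat) (A : 'M[R]_m) (B : 'M[R]_(m, d))
  (C : 'M[R]_(l, m)) (D : 'M[R]_(m, n)) (Rw : 'M[R]_d) (G : 'M[R]_m)
  (D1 : 'M[R]_(m, n)).
Hypotheses (hRw : posdef Rw) (hG : G = D1 *m D1^T).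

Lemma trace_subZ (X Y : 'M[R]_m) a :
  \tr ((X - a *: Y) *m D *m D^T) = \tr (X *m D *m D^T) - a * \tr (Y *m D *m D^T).
Proof. by rewrite !mulmxBl raddfB /= -!scalemxAl linearZ. Qed.

Let loop := loop_stab A B C Rw G.
Let gn := gain B Rw.

(** The choice of [H] turns the first-order effect of the gain change into [- 2 H^T Rw H]. *)
Lemma loop_ric_expansion (K H : 'M[R]_(d, m)) (P Y : 'M[R]_m) t :
  P^T = P -> Rw *m H = B^T *m P - Rw *m K ->
  brl_ric (A - B *m (K + t *: H)) G
    (C^T *m C + (K + t *: H)^T *m Rw *m (K + t *: H)) (P - t *: Y)
  = brl_ric (A - B *m K) G (C^T *m C + K^T *m Rw *m K) P
    - t *: (2 *: (H^T *m Rw *m H) + (A - B *m K + G *m P)^T *m Y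
            + Y *m (A - B *m K + G *m P))
    + t ^+ 2 *: (H^T *m Rw *m H + (B *m H)^T *m Y + Y *m (B *m H) + Y *m G *m Y).
Proof.
move=> hP e; have hS := gram_sym hG.
have e1 : B^T *m P = Rw *m H + Rw *m K by rewrite e subrK.
have e2 : P *m B = H^T *m Rw + K^T *m Rw.
  have := congr1 trmx e1; rewrite trmx_add !trmx_mul trmxK hP hRw.1.
  by [].
rewrite /brl_ric !(trmx_add, trmx_opp, trmx_mul, trmx_scale) hS hP.
mx_expand; rewrite -![H^T *m B^T *m P]mulmxA e1 e2.
by mx_norm; ring.
Qed.

(** [P - t *: Y] satisfies the strict Riccati inequality of the new loop, so [brl_strict] puts [P']
    below it. The small multiple of [W] subtracted from [X] provides the strictness. *)
Lemma descent K P X : loop K P ->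
  let H : 'M[R]_(d, m) := gn P - K in
  let M : 'M[R]_m := A - B *m K + G *m P in
  X^T = X -> M^T *m X + X *m M = - (2 *: (H^T *m Rw *m H)) ->
  0 < \tr (X *m D *m D^T) ->
  exists c t0, [/\ 0 < c, 0 < t0 & forall t, 0 < t -> t < t0 ->
    exists P', loop (K + t *: H) P' /\
      \tr (P' *m D *m D^T) <= \tr (P *m D *m D^T) - t * c].
Proof.
move=> st H M hX eX trX; have [pP r s] := st.
have eH : Rw *m H = B^T *m P - Rw *m K by rewrite /H mulmxBr (Rw_gain B hRw).
have [_ [_ hA _]] := brl_stab_perturb hG (weight_psd C hRw K) st.
have [W hW eW] := lyapunov_solve s (posdef1 R m).1.
have pW := lyapunov_posdef s (posdef1 R m) hW eW.
have [V hV eV] := lyapunov_solve hA (posdef1 R m).1.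
have pV := lyapunov_posdef hA (posdef1 R m) hV eV.
have trW := psd_congr_trace D (posdef_psd pW).
pose a := \tr (X *m D *m D^T); pose w := \tr (W *m D *m D^T).
(* Subtracting [del *: W] costs at most half of the trace [a]; the 1 covers [w = 0]. *)
pose del := a / (2 * (w + 1)).
have w1 : 0 < 2 * (w + 1) by rewrite mulr_gt0 // ltr_wpDl.
have dp : 0 < del by rewrite divr_gt0.
pose Y := X - del *: W.
have hY : Y^T = Y by rewrite /Y trmx_add trmx_opp trmx_scale hX hW.
have trY : a / 2 <= \tr (Y *m D *m D^T).
  have -> : \tr (Y *m D *m D^T) = a - del * w.
    exact: trace_subZ.
  have -> : a - del * w = a / 2 + a / (2 * (w + 1)).
    by rewrite /del; field; rewrite gt_eqF // ltr_wpDl.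
  by rewrite lerDl ltW.
have eY : M^T *m Y + Y *m M = - (2 *: (H^T *m Rw *m H)) + del *: 1%:M.
  have -> : M^T *m Y + Y *m M = (M^T *m X + X *m M) - del *: (M^T *m W + W *m M).
    by rewrite /Y; mx_norm; ring.
  by rewrite eX eW scalerN opprK.
clearbody Y H.
pose S := H^T *m Rw *m H + (B *m H)^T *m Y + Y *m (B *m H) + Y *m G *m Y.
have hS : S^T = S.
  rewrite /S !trmx_add !trmx_mul !trmxK hY (gram_sym hG) hRw.1 !mulmxA.
  by mx_norm; ring.
pose S2 : 'M[R]_m := - ((B *m H)^T *m V + V *m (B *m H)).
have hS2 : S2^T = S2.
  by rewrite /S2 trmx_opp trmx_add !trmx_mul !trmxK hV !mulmxA; mx_norm; ring.
have [t1 t1p h1] := small_posdef hS; have [t2 t2p h2] := small_posdef hS2.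
(* [t1 * del] keeps the quadratic term [S] below the margin [del]; [t2] keeps the new loop Hurwitz,
   with [V] as certificate. *)
exists (a / 2), (Num.min (t1 * del) t2); split.
- by rewrite divr_gt0.
- by rewrite lt_min t2p mulr_gt0.
move=> t tp; rewrite lt_min => /andP[tl1 tl2].
have hAt : hurwitz (A - B *m (K + t *: H)).
  apply: (lyapunov_hurwitz pV).
  have -> : - ((A - B *m (K + t *: H))^T *m V + V *m (A - B *m (K + t *: H)))
      = 1%:M - t *: S2.
    have -> : 1%:M = - ((A - B *m K)^T *m V + V *m (A - B *m K)) by rewrite eV opprK.
    by rewrite /S2 !(trmx_add, trmx_opp, trmx_mul, trmx_scale); mx_norm; ring.
  by apply: h2 => //; exact: ltW.
have hPY : (P - t *: Y)^T = P - t *: Y by rewrite trmx_add trmx_opp trmx_scale hY pP.1.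
have [|P' st' pP'] := brl_strict hG (weight_psd C hRw (K + t *: H)) hAt hPY.
  rewrite loop_ric_expansion //; last exact: pP.1.
  rewrite r -/M -/S -[2 *: _ + _ + _]addrA eY.
  have -> : - (0 - t *: (2 *: (H^T *m Rw *m H) + (- (2 *: (H^T *m Rw *m H)) + del *: 1%:M))
      + t ^+ 2 *: S) = (t * del) *: (1%:M - (t / del) *: S).
    by clearbody S; mx_norm; field; rewrite gt_eqF.
  apply: posdefZ; first exact: mulr_gt0.
  by apply: h1; rewrite ?ltr_pdivrMr // divr_ge0 // ltW.
exists P'; split; first exact: st'.
have := psd_congr_trace D pP'.
have -> : \tr ((P - t *: Y - P') *m D *m D^T)
    = \tr (P *m D *m D^T) - t * \tr (Y *m D *m D^T) - \tr (P' *m D *m D^T).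
  by rewrite -[P']scale1r !trace_subZ mul1r scale1r.
move: trY; set y := \tr (Y *m D *m D^T) => ya h.
have : t * (a / 2) <= t * y by rewrite ler_pM2l.
by move: h; lra.
Qed.


(* [tr (X D D^T)] is the first-order rate in [descent]. *)
Lemma no_descent_krylov (M X : 'M[R]_m) (H : 'M[R]_(d, m)) :
  psd X -> M^T *m X + X *m M = - (2 *: (H^T *m Rw *m H)) ->
  \tr (X *m D *m D^T) = 0 ->
  forall k, H *m (M ^+ k *m D) = 0.
Proof.
move=> pX eX trX.
have step q (Z : 'M[R]_(m, q)) : X *m Z = 0 -> H *m Z = 0 /\ X *m (M *m Z) = 0.
  move=> XZ.
  have ZX : Z^T *m X = 0 by rewrite -pX.1 -trmx_mul XZ trmx0.
  have HZ : H *m Z = 0.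
    apply: (posdef_congr_eq0 hRw); rewrite trmx_mul.
    have : Z^T *m (M^T *m X + X *m M) *m Z = 0.
      rewrite mulmxDr mulmxDl !mulmxA -[_ *m X *m Z]mulmxA XZ ZX.
      by rewrite !(mulmx0, mul0mx) addr0.
    rewrite eX mulmxN mulNmx -scalemxAr -scalemxAl !mulmxA => /eqP.
    by rewrite oppr_eq0 scaler_eq0 pnatr_eq0 /= => /eqP.
  split=> //.
  have : (M^T *m X + X *m M) *m Z = 0.
    by rewrite eX mulNmx -scalemxAl -[_ *m H *m Z]mulmxA HZ mulmx0 scaler0 oppr0.
  by rewrite mulmxDl -!mulmxA XZ mulmx0 add0r.
have XD := psd_congr_trace_eq0 pX trX.
move=> k; suff: X *m (M ^+ k *m D) = 0 by case/step.
elim: k => [|k /step[_ IH]]; first by rewrite expr0 mul1mx.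
by rewrite exprS -mulmxE -mulmxA.
Qed.

(* On the controllable subspace of the second loop the two Riccati solutions
   agree by a Sylvester argument, so the two closed loops agree there as well. *)
Lemma gain_krylov_unique K P Ps : loop (gn Ps) Ps -> loop K P ->
  let H : 'M[R]_(d, m) := gn P - K in
  let M : 'M[R]_m := A - B *m K + G *m P in
  (forall k, H *m (M ^+ k *m D) = 0) ->
  controllable (A - B *m gn Ps + G *m Ps) D -> K = gn Ps.
Proof.
move=> st1 st2 H M hH ctr.
have [r1 s1] := stab_gare hRw st1; have [p1 _ s1'] := st1.
have [p2 r2 s2] := st2.
set N := B *m invmx Rw *m B^T - G in r1 s1 *.
have hN : N^T = N := quad_sym B hRw hG.
pose De : 'M[R]_m := P - Ps.
have r2' : gare A B C Rw G P = - (H^T *m Rw *m H).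
  have := complete_square A B C G hRw K p2.1; rewrite r2 => /esym/eqP.
  rewrite addr_eq0 => /eqP ->; congr (- _).
  have -> : K - gain B Rw P = - H by rewrite /H opprB.
  by rewrite trmx_opp !mulNmx mulmxN opprK.
have MP : A - N *m P = M - B *m H.
  rewrite /M /H mulmxBr B_gain /N.
  by mx_norm; ring.
have eK : K = gn P - H by rewrite /H opprB addrCA subrr addr0.
rewrite -/M in s2; clearbody H M.
(* The difference of the two Riccati equations; its right side vanishes on the Krylov vectors
   because [H] does. *)
have eD : (A - N *m Ps)^T *m De + De *m (M - B *m H) = - (H^T *m Rw *m H).
  rewrite -r2' -[RHS]subr0 -r1 -MP /gare /ric -/N /De trmx_add trmx_opp trmx_mul hN p1.1.
  by mx_norm; ring.
have Mk k : M *m (M ^+ k *m D) = M ^+ k.+1 *m D by rewrite exprS -mulmxE mulmxA.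
have Dk : forall k, De *m (M ^+ k *m D) = 0.
  apply: (sylvester_krylov_real s1 s2) => k.
  have eM : (M - B *m H) *m (M ^+ k *m D) = M ^+ k.+1 *m D.
    by rewrite mulmxBl -(mulmxA B H) hH mulmx0 subr0 Mk.
  have eR : - (H^T *m Rw *m H) *m (M ^+ k *m D) = 0.
    by rewrite mulNmx -(mulmxA _ H) hH mulmx0 oppr0.
  by rewrite -eM; apply: etrans eR; rewrite -eD [RHS]mulmxDl !mulmxA.
(* The two loops differ by terms vanishing on the Krylov vectors, so both generate the same vectors
   from [D]. *)
have Ms : A - B *m gn Ps + G *m Ps = M + N *m De - B *m H.
  have -> : M = A - N *m P + B *m H by rewrite MP subrK.
  by rewrite /gn gain_loop -/N /De; mx_norm; ring.
have pk k : (A - B *m gn Ps + G *m Ps) ^+ k *m D = M ^+ k *m D.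
  elim: k => [|k IH]; first by rewrite !expr0.
  rewrite exprS -mulmxE -mulmxA IH Ms mulmxBl mulmxDl Mk -!mulmxA Dk hH.
  by rewrite !mulmx0 addr0 subr0.
apply/eqP; rewrite -subr_eq0; apply/eqP; apply: (krylov_inj ctr) => k.
rewrite pk.
have -> : K - gn Ps = invmx Rw *m B^T *m De - H.
  by rewrite eK /gn /gain /De; mx_norm; ring.
by rewrite mulmxBl hH -(mulmxA _ De) Dk mulmx0 subr0.
Qed.

End Descent.

(** * Feasibility, cost and first-order conditions *)

Section Cost.
Variables (R : realType) (m n d l : nat) (A : 'M[R]_m) (B : 'M[R]_(m, d))
  (C : 'M[R]_(l, m)) (D : 'M[R]_(m, n)) (Rw : 'M[R]_d) (gamma : R).
Hypotheses (hRw : posdef Rw) (g0 : 0 < gamma).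

Let G : 'M[R]_m := gamma ^- 2 *: (D *m D^T).
Let hG : G = (gamma^-1 *: D) *m (gamma^-1 *: D)^T := scaled_gramE D gamma.
Let loop := loop_stab A B C Rw G.
Let J := cost A B C D Rw gamma.

Lemma stabilizing_solutionE K P :
  stabilizing_solution A B C D Rw gamma K P <-> loop K P.
Proof.
have e1 : (A - B *m K)^T *m P + P *m (A - B *m K) + C^T *m C + K^T *m Rw *m K
    + gamma ^- 2 *: (P *m D *m D^T *m P)
    = brl_ric (A - B *m K) G (C^T *m C + K^T *m Rw *m K) P.
  by rewrite /brl_ric /G -scalemxAr -scalemxAl !mulmxA !addrA.
have e2 : gamma ^- 2 *: (D *m D^T *m P) = G *m P by rewrite /G -scalemxAl.
by rewrite /stabilizing_solution e1 e2.
Qed.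

Lemma feasible_loop K : feasible A B C D Rw gamma K -> exists P, loop K P.
Proof. by move=> [hK hT]; exact: (hinf_stab (weight_psd C hRw K) g0 hK hT). Qed.

Lemma loop_feasible K P : loop K P -> feasible A B C D Rw gamma K.
Proof. by move=> h; have [hK hT] := stab_hinf (weight_psd C hRw K) g0 h; split. Qed.

Lemma riccati_solE K P : loop K P -> riccati_sol A B C D Rw gamma K = P.
Proof.
move=> h; have := @xgetI _ 0 [set P | stabilizing_solution A B C D Rw gamma K P]%classic P
  ((stabilizing_solutionE K P).2 h).
by move/stabilizing_solutionE => h'; exact: (brl_stab_unique hG h' h).
Qed.

Lemma costE K P : loop K P -> J K = \tr (P *m D *m D^T).
Proof. by move=> h; rewrite /J /cost (riccati_solE h). Qed.

Lemma gradient_derive (f : 'M[R]_(d, m) -> R) K H :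
  differentiable f K -> gradient f K = 0 -> 'D_H f K = 0.
Proof.
move=> df g; rewrite deriveE // (matrix_sum_delta H) linear_sum big1 // => i _.
rewrite linear_sum big1 // => j _; rewrite linearZ /= -deriveE //.
by move/matrixP: g => /(_ i j); rewrite !mxE => ->; rewrite scaler0.
Qed.

(** The right-hand difference quotients would be at most [- c], and so would their limit. *)
Lemma derive_no_descent (f : 'M[R]_(d, m) -> R) K H c t0 :
  derivable f K H -> 'D_H f K = 0 -> 0 < c -> 0 < t0 ->
  ~ (forall t, 0 < t -> t < t0 -> f (K + t *: H) <= f K - t * c).
Proof.
move=> df D0 c0 t00 h.
have : ((fun h => h^-1 *: ((f \o shift K) (h *: H) - f K)) @ 0^'+ --> 'D_H f K)%classic.
  by apply: cvg_dnbhs_at_right; exact: df.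
rewrite D0.
move=> cv; suff : (0 : R) <= - c by rewrite oppr_ge0 leNgt c0.
apply: (closed_cvg (fun x => x <= - c) _ _ _ cv); first exact: closed_le.
near=> t.
have tp : 0 < t by near: t; exact: nbhs_right_gt.
have tl : t < t0 by near: t; exact: nbhs_right_lt.
rewrite /= [t *: H + K]addrC /GRing.scale /= mulrC ler_pdivrMr //.
by rewrite lerBlDl mulNr mulrC h.
Unshelve. all: by end_near.
Qed.

(** The common core of the stationary and the optimal case: [X] is semidefinite, so its trace is
    nonnegative, and [descent] excludes a positive one. *)
Lemma no_descent K P : loop K P ->
  (forall H c t0, 0 < c -> 0 < t0 ->
     ~ (forall t, 0 < t -> t < t0 -> feasible A B C D Rw gamma (K + t *: H) /\
          J (K + t *: H) <= J K - t * c)) ->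
  forall k, (gain B Rw P - K) *m ((A - B *m K + G *m P) ^+ k *m D) = 0.
Proof.
move=> st nd; have [pP r s] := st.
set H : 'M[R]_(d, m) := gain B Rw P - K.
have pH : psd (2 *: (H^T *m Rw *m H)) by apply/psdZ/psd_congr/posdef_psd.
have [X hX eX] := lyapunov_solve s pH.1.
have pX : psd X by apply: (lyapunov_real s hX); rewrite eX opprK.
apply: (no_descent_krylov hRw pX eX).
apply/eqP; rewrite eq_le psd_congr_trace // andbT leNgt; apply/negP => trX.
have [c [t0 [c0 t00 h]]] := descent hRw hG st hX eX trX.
apply: (nd H c t0 c0 t00) => t tp tl; have [P' [st' le']] := h t tp tl.
by split; [exact: loop_feasible st' | rewrite (costE st') (costE st)].
Qed.

Lemma stationary_krylov K P : loop K P -> stationary A B C D Rw gamma K ->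
  forall k, (gain B Rw P - K) *m ((A - B *m K + G *m P) ^+ k *m D) = 0.
Proof.
move=> st [_ dJ gJ]; apply: (no_descent st) => H c t0 c0 t00 h.
apply: (derive_no_descent _ (gradient_derive H dJ gJ) c0 t00).
  exact: diff_derivable.
by move=> t tp tl; have [] := h t tp tl.
Qed.

Lemma optimum_krylov K P : loop K P -> global_optimum A B C D Rw gamma K ->
  forall k, (gain B Rw P - K) *m ((A - B *m K + G *m P) ^+ k *m D) = 0.
Proof.
move=> st [_ op]; apply: (no_descent st) => H c t0 c0 t00 h.
have tp : 0 < t0 / 2 by rewrite divr_gt0.
have tl : t0 / 2 < t0 by rewrite ltr_pdivrMr // ltr_pMr // ltr1n.
have [fe le1] := h _ tp tl.
have := le_trans (op _ fe) le1.
by rewrite -subr_ge0 addrAC subrr add0r oppr_ge0 leNgt mulr_gt0.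
Qed.

End Cost.

Theorem propositionA5 (R : realType) (m n d l : nat)
    (A : 'M[R]_m) (B : 'M[R]_(m, d)) (C : 'M[R]_(l, m)) (D : 'M[R]_(m, n))
    (E : 'M[R]_(l, d)) (Rw : 'M[R]_d) (gamma : R)
    (hRw : posdef Rw)
    (hE : E^T *m row_mx C E = row_mx 0 Rw)
    (hgamma : 0 < gamma)
    (hopt : exists K : 'M[R]_(d, m), global_optimum A B C D Rw gamma K)
    (hdet : detectable A C) :
  exists Kstar : 'M[R]_(d, m),
    [/\ global_optimum A B C D Rw gamma Kstar,
        Kstar = invmx Rw *m B^T *m riccati_sol A B C D Rw gamma Kstar
      & forall K : 'M[R]_(d, m),
          stationary A B C D Rw gamma K ->
          controllable
            (A - B *m K
               + gamma ^- 2 *: (D *m D^T *m riccati_sol A B C D Rw gamma K)) D ->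
          [/\ forall K' : 'M[R]_(d, m),
                stationary A B C D Rw gamma K' -> K' = K,
              K = Kstar
            & forall K' : 'M[R]_(d, m),
                global_optimum A B C D Rw gamma K' -> K' = K]].
Proof.
have hG := scaled_gramE D gamma.
set G := gamma ^- 2 *: (D *m D^T) in hG.
(* The given optimum supplies the feasible loop from which [gare_minimal] starts. *)
have [K0 [/(feasible_loop hRw hgamma)[P0 st0] _]] := hopt.
have [|Ps [pPs r s Pmin]] := @gare_minimal _ _ _ _ _ A B C Rw G _ hRw hG hdet.
  by exists K0, P0.
have sts := gare_stab hRw pPs r s.
set Ks := gain B Rw Ps in sts.
have fs := loop_feasible hRw hgamma sts.
have eKs := riccati_solE sts.
exists Ks; split.
- split=> [|K' /(feasible_loop hRw hgamma)[P' st']]; first exact: fs.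
  rewrite (costE sts) (costE st') -subr_ge0.
  have := psd_congr_trace D (Pmin _ _ st').
  by rewrite -[Ps in _ - Ps]scale1r trace_subZ mul1r.
- by rewrite eKs.
move=> K stK ctr.
have [P st] := feasible_loop hRw hgamma (let: And3 f _ _ := stK in f).
have hK := stationary_krylov hRw hgamma st stK.
have eG : gamma ^- 2 *: (D *m D^T *m P) = G *m P by rewrite /G -scalemxAl.
rewrite (riccati_solE st) eG in ctr.
(* Controllability turns vanishing on the Krylov vectors into [gain B Rw P - K = 0]. *)
have eK : K = gain B Rw P.
  by apply/eqP; rewrite eq_sym -subr_eq0; apply/eqP; exact: (krylov_inj ctr hK).
have stg : loop_stab A B C Rw G (gain B Rw P) P by rewrite -eK.
have [pP _ _] := st.
have [rP sP] := stab_gare hRw stg.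
have ePs : P = Ps := gare_unique hRw hG pP rP r sP s.
have {}ctr : controllable (A - B *m gain B Rw P + G *m P) D by rewrite -eK.
split.
(* Controllability is given at [K] only; [gain_krylov_unique] carries it over to the Krylov space of
   [K']. *)
- move=> K' stK'.
  have [P' st'] := feasible_loop hRw hgamma (let: And3 f _ _ := stK' in f).
  rewrite eK; apply: (gain_krylov_unique hRw hG stg st' _ ctr).
  exact: stationary_krylov stK'.
- by rewrite eK ePs.
- move=> K' opt'; have [P' st'] := feasible_loop hRw hgamma opt'.1.
  rewrite eK; apply: (gain_krylov_unique hRw hG stg st' _ ctr).
  exact: optimum_krylov opt'.
Qed.
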